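(* Let $\bm{C}_1,\bm{C}_2\subset\mathbb{P}^3(\mathbb{R})$ be two rational algebraic curves properly parametrized by homogeneous parametrizations $\bm{p},\bm{q}$ of the same degree $n\ge 4$, satisfying hypotheses (i)-(iv) listed in the context. Then $\bm{C}_1,\bm{C}_2$ are projectively equivalent if and only if there exist two linear functions $u:=at_0+bt_1$, $v:=ct_0+dt_1$ with $a,b,c,d\in\mathbb{R}$, $ad-bc\neq 0$, satisfying $$\kappa_1(\bm{p})(t_0,t_1)=\kappa_1(\bm{q})(u,v),\qquad \kappa_2(\bm{p})(t_0,t_1)=\kappa_2(\bm{q})(u,v),$$ and such that, with $\varphi(t_0,t_1)=(at_0+bt_1,ct_0+dt_1)$, the matrix $D(\bm{q}\circ\varphi)\,(D(\bm{p}))^{-1}$ is a constant matrix $M$. Furthermore, $f(\bm{x})=M\cdot\bm{x}$ is a projective equivalence between $\bm{C}_1$ and $\bm{C}_2$.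
   Context: A curve $\bm{C}\subset\mathbb{P}^3(\mathbb{R})$ is given by a homogeneous parametrization $\bm{p}:\mathbb{P}^1(\mathbb{R})\to\bm{C}$, $\bm{p}(t_0,t_1)=(p_0,p_1,p_2,p_3)$ (a column vector), whose components are real homogeneous polynomials of degree $n$ in $t_0,t_1$. Hypotheses on $\bm{p},\bm{q}$: (i) $\bm{p}$ and $\bm{q}$ are proper, i.e. birational onto $\bm{C}_1$, $\bm{C}_2$ (almost all points of each curve are reached); (ii) $\gcd(p_0,p_1,p_2,p_3)=\gcd(q_0,q_1,q_2,q_3)=1$; (iii) $\bm{p}$ and $\bm{q}$ have the same degree $n\ge 4$; (iv) neither curve is contained in a hyperplane (so the $4\times(n+1)$ coefficient matrices have rank 4). A projectivity is a map $f:\mathbb{P}^3(\mathbb{R})\to\mathbb{P}^3(\mathbb{R})$, $f(\bm{x})=M\cdot\bm{x}$, with $M$ a non-singular real $4\times4$ matrix (defined up to nonzero scalar). $\bm{C}_1,\bm{C}_2$ are projectively equivalent if there is a projectivity $f$ with $f(\bm{C}_1)=\bm{C}_2$; such an $f$ is called a projective equivalence. Notation: $\bm{u}_{t_0^kt_1^l}=\partial^{k+l}\bm{u}/\partial t_0^k\partial t_1^l$; $[\bm{w}_1\,\ldots\,\bm{w}_4]$ is the matrix with columns $\bm{w}_i$ and $\Vert\bm{w}_1\,\ldots\,\bm{w}_4\Vert$ its determinant. Put $$D(\bm{u})=[\bm{u}_{t_0}\,\bm{u}_{t_1}\,\bm{u}_{t_0^2}\,\bm{u}_{t_0^3}],\qquad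 \Delta(\bm{u})=\Vert \bm{u}_{t_0}\,\bm{u}_{t_1}\,\bm{u}_{t_0^2}\,\bm{u}_{t_0^3}\Vert,$$ $$A_1(\bm{u})=\Vert \bm{u}_{t_0^4}\,\bm{u}_{t_1}\,\bm{u}_{t_0^2}\,\bm{u}_{t_0^3}\Vert,\quad A_2(\bm{u})=\Vert \bm{u}_{t_0}\,\bm{u}_{t_0^4}\,\bm{u}_{t_0^2}\,\bm{u}_{t_0^3}\Vert,\quad A_3(\bm{u})=\Vert \bm{u}_{t_0}\,\bm{u}_{t_1}\,\bm{u}_{t_0^4}\,\bm{u}_{t_0^3}\Vert,\quad A_4(\bm{u})=\Vert \bm{u}_{t_0}\,\bm{u}_{t_1}\,\bm{u}_{t_0^2}\,\bm{u}_{t_0^4}\Vert,$$ $I_i(\bm{u})=A_i(\bm{u})/\Delta(\bm{u})$ for $i=1,2,3,4$, and $I_0(\bm{u})=t_1I_1(\bm{u})-t_0I_2(\bm{u})$. The projective curvatures are the rational functions of $(t_0,t_1)$ $$\kappa_1(\bm{u})=\frac{\left(8(n-3)^2I_0+4(n-1)(n-3)t_1I_3I_4+(n-1)(n-2)t_1I_4^3\right)^2}{t_1^2\left(8(n-3)I_3+3(n-2)I_4^2\right)^3},$$ $$\kappa_2(\bm{u})=\frac{256(n-3)^3I_2+64(n-3)^2I_0I_4+16(n-1)(n-3)t_1I_3I_4^2+3(n-1)(n-2)t_1I_4^4}{t_1\left(8(n-3)I_3+3(n-2)I_4^2\right)^2},$$ where $I_j=I_j(\bm{u})$. $\kappa_i(\bm{q})(u,v)$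 denotes $\kappa_i(\bm{q})$ evaluated at $(t_0,t_1)=(u,v)$; the equalities are identities of rational functions in $t_0,t_1$. *)

(* Defs.v *)
From HB Require Import structures.
From mathcomp Require Import all_boot all_order all_algebra.
From mathcomp Require Import reals.
From mathcomp Require Import mpoly.

Set Implicit Arguments.
Unset Strict Implicit.
Unset Printing Implicit Defensive.

Import GRing.Theory.
Local Open Scope ring_scope.

Section ProjectiveCurves.

Variable R : realType.

(* A point of P^m(R) is given by homogeneous coordinates: a nonzero column
   vector of length m.+1, taken up to the relation [same_point]. *)
Definition same_point m (x y : 'cV[R]_m) : Prop :=
  exists2 l : R, l != 0 & y = l *: x.

Definition homogeneous m k (n : nat) (u : 'cV[{mpoly R[k]}]_m) : Prop :=
  forall i, u i 0 \is n.-homog.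

Definition evalv m k (u : 'cV[{mpoly R[k]}]_m) (x : 'cV[R]_k) : 'cV[R]_m :=
  map_mx (meval (fun i => x i 0)) u.

(* The algebraic curve parametrized by u: the Zariski closure in P^3(R) of the
   set of points u(t), t in P^1(R), so that almost all, but possibly not all,
   points of the curve are reached. As a set of homogeneous coordinate vectors
   it is closed under multiplication by nonzero scalars. *)
Definition curve (u : 'cV[{mpoly R[2]}]_4) (x : 'cV[R]_4) : Prop :=
  x != 0 /\
  forall (d : nat) (F : {mpoly R[4]}), F \is d.-homog ->
    (forall t : 'cV[R]_2, t != 0 -> F.@[fun i => evalv u t i 0] = 0) ->
    F.@[fun i => x i 0] = 0.

(* u is birational onto its curve: there is a rational map (g_0 : g_1) from the
   curve to P^1(R), defined at some u(t) and hence almost everywhere since the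
   curve is irreducible, which is a two-sided inverse of u wherever the
   composites are defined. *)
Definition proper_param (u : 'cV[{mpoly R[2]}]_4) : Prop :=
  exists (d : nat) (g : 'cV[{mpoly R[4]}]_2),
    [/\ homogeneous d g,
        exists t : 'cV[R]_2,
          [/\ t != 0, evalv u t != 0 & evalv g (evalv u t) != 0],
        forall t : 'cV[R]_2, t != 0 -> evalv u t != 0 ->
          evalv g (evalv u t) != 0 -> same_point t (evalv g (evalv u t))
      & forall x : 'cV[R]_4, curve u x -> evalv g x != 0 ->
          evalv u (evalv g x) != 0 -> same_point x (evalv u (evalv g x))].

(* gcd(u_0, u_1, u_2, u_3) = 1 *)
Definition coprime_components (u : 'cV[{mpoly R[2]}]_4) : Prop :=
  forall g : {mpoly R[2]},
    (forall i, exists h, u i 0 = g * h) -> g \is a GRing.unit.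

Definition in_hyperplane (C : 'cV[R]_4 -> Prop) : Prop :=
  exists2 h : 'rV[R]_4, h != 0 & forall x, C x -> h *m x = 0.

(* The projectivity x |-> M x maps C1 onto C2. *)
Definition projective_equivalence (M : 'M[R]_4) (C1 C2 : 'cV[R]_4 -> Prop)
    : Prop :=
  M \in unitmx /\ forall y, C2 y <-> exists2 x, C1 x & y = M *m x.

Definition projectively_equivalent (C1 C2 : 'cV[R]_4 -> Prop) : Prop :=
  exists M : 'M[R]_4, projective_equivalence M C1 C2.

End ProjectiveCurves.

Section Curvatures.

Variable R : realType.

Notation P := {mpoly R[2]}.
Notation K := {fraction P}.

(* t_0 is the variable of index 0 and t_1 that of index 1. *)
Notation "''t_0'" := ('X_(0 : 'I_2) : P).
Notation "''t_1'" := ('X_(1 : 'I_2) : P).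

(* The partial derivative of u, k times in t_0 and l times in t_1. *)
Definition pderiv (k l : nat) (u : 'cV[P]_4) : 'cV[P]_4 :=
  map_mx (fun f : P => f^`M(0 : 'I_2, k)^`M(1 : 'I_2, l)) u.

Definition cols4 (w1 w2 w3 w4 : 'cV[P]_4) : 'M[P]_4 :=
  \matrix_(i, j) (tnth [tuple w1; w2; w3; w4] j) i 0.

Definition Dmx (u : 'cV[P]_4) : 'M[P]_4 :=
  cols4 (pderiv 1 0 u) (pderiv 0 1 u) (pderiv 2 0 u) (pderiv 3 0 u).

Definition Delta (u : 'cV[P]_4) : P := \det (Dmx u).

Definition A1 (u : 'cV[P]_4) : P :=
  \det (cols4 (pderiv 4 0 u) (pderiv 0 1 u) (pderiv 2 0 u) (pderiv 3 0 u)).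
Definition A2 (u : 'cV[P]_4) : P :=
  \det (cols4 (pderiv 1 0 u) (pderiv 4 0 u) (pderiv 2 0 u) (pderiv 3 0 u)).
Definition A3 (u : 'cV[P]_4) : P :=
  \det (cols4 (pderiv 1 0 u) (pderiv 0 1 u) (pderiv 4 0 u) (pderiv 3 0 u)).
Definition A4 (u : 'cV[P]_4) : P :=
  \det (cols4 (pderiv 1 0 u) (pderiv 0 1 u) (pderiv 2 0 u) (pderiv 4 0 u)).

Definition tof (f : P) : K := tofrac f.

Definition I1 (u : 'cV[P]_4) : K := tof (A1 u) / tof (Delta u).
Definition I2 (u : 'cV[P]_4) : K := tof (A2 u) / tof (Delta u).
Definition I3 (u : 'cV[P]_4) : K := tof (A3 u) / tof (Delta u).
Definition I4 (u : 'cV[P]_4) : K := tof (A4 u) / tof (Delta u).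
Definition I0 (u : 'cV[P]_4) : K := tof 't_1 * I1 u - tof 't_0 * I2 u.

(* n is the degree of the parametrization u. Division by zero in K gives 0, so
   kappa1 n u = kappa2 n u = 0 should 8 (n-3) I_3 + 3 (n-2) I_4^2 vanish
   identically. For a curve not in a hyperplane, Delta u is not zero. *)
Definition kappa1 (n : nat) (u : 'cV[P]_4) : K :=
  let m : K := n%:R in
  let t1 := tof 't_1 in
  (8 * (m - 3) ^+ 2 * I0 u + 4 * (m - 1) * (m - 3) * t1 * I3 u * I4 u
     + (m - 1) * (m - 2) * t1 * I4 u ^+ 3) ^+ 2
  / (t1 ^+ 2 * (8 * (m - 3) * I3 u + 3 * (m - 2) * I4 u ^+ 2) ^+ 3).

Definition kappa2 (n : nat) (u : 'cV[P]_4) : K :=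
  let m : K := n%:R in
  let t1 := tof 't_1 in
  (256 * (m - 3) ^+ 3 * I2 u + 64 * (m - 3) ^+ 2 * I0 u * I4 u
     + 16 * (m - 1) * (m - 3) * t1 * I3 u * I4 u ^+ 2
     + 3 * (m - 1) * (m - 2) * t1 * I4 u ^+ 4)
  / (t1 * (8 * (m - 3) * I3 u + 3 * (m - 2) * I4 u ^+ 2) ^+ 2).

Definition linsubst (a b c d : R) : 2.-tuple P :=
  [tuple a *: 't_0 + b *: 't_1; c *: 't_0 + d *: 't_1].

(* The composite u o phi. *)
Definition compv (u : 'cV[P]_4) (phi : 2.-tuple P) : 'cV[P]_4 :=
  map_mx (fun f : P => f \mPo phi) u.

(* The rational function f evaluated at (t_0, t_1) = phi. The value does not
   depend on the chosen fraction as long as the two components of phi are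
   algebraically independent, e.g. for phi = linsubst a b c d with
   a d - b c != 0. *)
Definition evalf (f : K) (phi : 2.-tuple P) : K :=
  tof (\n_(repr f) \mPo phi) / tof (\d_(repr f) \mPo phi).

Definition Dquotient (p q : 'cV[P]_4) (phi : 2.-tuple P) : 'M[K]_4 :=
  map_mx tof (Dmx (compv q phi)) *m invmx (map_mx tof (Dmx p)).

Definition constmx (M : 'M[R]_4) : 'M[K]_4 :=
  map_mx (fun r => tof r%:MP) M.

Definition curvature_match (n : nat) (p q : 'cV[P]_4) (a b c d : R)
    (M : 'M[R]_4) : Prop :=
  [/\ a * d - b * c != 0,
      kappa1 n p = evalf (kappa1 n q) (linsubst a b c d),
      kappa2 n p = evalf (kappa2 n q) (linsubst a b c d)
    & Dquotient p q (linsubst a b c d) = constmx M].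

End Curvatures.

(* Main.v *)
Require Import Defs.
From mathcomp Require Import all_boot all_order all_algebra.
From mathcomp Require Import reals.
From mathcomp Require Import mpoly.
From HB Require Import structures.
From mathcomp Require Import perm ring.

Set Implicit Arguments.
Unset Strict Implicit.
Unset Printing Implicit Defensive.

Import GRing.Theory Num.Theory.
Local Open Scope ring_scope.

(** Write phi for the substitution of U = a t_0 + b t_1 for t_0 and of V = c t_0 + d t_1
    for t_1, and delta for a d - b c.

    The conditions are sufficient because D(q o phi) = M D(p) says in its first two
    columns that q o phi and M p have the same first derivatives, so that q o phi = M p
    by Euler's relation ([Dmx_inj]). As phi permutes the projective line, M carries
    one curve onto the other ([curve_equivalence]); it is invertible because the
    curve of q spans the space.

    Conversely let M carry the curve of p onto that of q. The polynomial inverse of q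
    turns M p into a pair of forms which, substituted in q, gives back M p up to a
    factor. Since p and q have coprime components and the same degree, comparing
    degrees shows that this pair is linear after division by its greatest common
    divisor: q o phi = l M p for a nonzero scalar l ([curve_reparam], resting on the
    univariate statement [linear_of_coprime_relation]). So D(q o phi) = l M D(p), and it
    remains to see that the curvatures of p are those of q composed with phi. The
    functions I_1, .., I_4 are the coordinates of the fourth derivative in the frame
    D, hence do not change under a projectivity ([kappa_mul]). Under phi they change
    by an explicit affine rule with coefficients in rho = delta t_1 / V and c / V, for
    which the numerators of the curvatures divided by t_1 and the base of their
    denominators are relative invariants of weights 3, 4 and 2: the powers of rho cancel
    ([kappa_compv]).

    All of this rests on the invertibility of D(p) and D(q). At t_1 = 1 their determinants
    become, up to sign and the factor n, Wronskians of the components, and the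
    Wronskian of linearly independent polynomials does not vanish in characteristic
    zero ([wronskian_neq0], [Delta_neq0]). *)

(** * Polynomials in several variables: substitution, forms, derivatives *)

(** Polynomials are generated, as a ring, by the constants and the variables;
    identities between substitutions are checked on these generators. *)
Lemma mpoly_rmorph_eq k (R : nzRingType) (S : comNzRingType)
    (f g : {rmorphism {mpoly R[k]} -> S}) :
  (forall c, f c%:MP = g c%:MP) -> (forall i, f 'X_i = g 'X_i) -> f =1 g.
Proof.
move=> fgC fgX p; rewrite [p]mpolyE !rmorph_sum; apply: eq_bigr => m _.
rewrite -mul_mpolyC !rmorphM fgC mpolyXE_id !rmorph_prod; congr (_ * _).
by apply: eq_bigr => i _; rewrite !rmorphXn fgX.
Qed.

Lemma comp_mpolyA k l m (R : comNzRingType) (p : {mpoly R[k]})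
    (s : k.-tuple {mpoly R[l]}) (t : l.-tuple {mpoly R[m]}) :
  (p \mPo s) \mPo t = p \mPo [tuple tnth s i \mPo t | i < k].
Proof.
pose f : {rmorphism _ -> _} := comp_mpoly t \o comp_mpoly s.
rewrite -[LHS]/(f p); apply: mpoly_rmorph_eq => [c|i] /=.
  by rewrite !comp_mpolyC.
by rewrite !comp_mpolyXU -!tnth_nth tnth_mktuple.
Qed.

Lemma dhomog_comp k l (R : comNzRingType) d e (p : {mpoly R[k]})
    (s : k.-tuple {mpoly R[l]}) :
  p \is d.-homog -> (forall i, tnth s i \is e.-homog) ->
  p \mPo s \is (d * e).-homog.
Proof.
move=> /dhomogP hp hs; rewrite comp_mpolyEX big_seq.
apply: rpred_sum => m /hp /esym dm; apply: dhomogZ.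
rewrite comp_mpolyX dm /= mdegE big_distrl /=; elim/big_ind2: _ => [|x a y b|i _].
- exact: dhomog1.
- by move=> hx hy; apply: dhomogM.
- by rewrite mulnC; apply: dhomogMn.
Qed.

Lemma mmap_homog k (R : nzRingType) (S : comNzRingType) (f : {rmorphism R -> S})
    (v : 'I_k -> S) n h (p : {mpoly R[k]}) :
  p \is n.-homog -> mmap f (fun i => h * v i) p = h ^+ n * mmap f v p.
Proof.
move=> /dhomogP hp; rewrite /mmap big_distrr /= !big_seq.
apply: eq_bigr => m /hp /= <-; rewrite mulrCA; congr (_ * _).
rewrite /mmap1 [mdeg m]mdegE -prodrXr -big_split /=.
by apply: eq_bigr => i _; rewrite exprMn.
Qed.

Lemma dhomog_mderiv k (R : nzRingType) n i (p : {mpoly R[k]}) :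
  p \is n.-homog -> p^`M(i) \is n.-1.-homog.
Proof.
move=> /dhomogP hp; apply/dhomogP => m; rewrite mcoeff_msupp mcoeff_mderiv.
move=> pm; have /hp /= <- : (m + U_(i))%MM \in msupp p.
  by rewrite mcoeff_msupp; apply: contraNneq pm => ->; rewrite mul0rn.
by rewrite mdegD mdeg1 addn1.
Qed.

Lemma dhomog_mderivn k (R : nzRingType) n i j (p : {mpoly R[k]}) :
  p \is n.-homog -> p^`M(i, j) \is (n - j).-homog.
Proof.
move=> hp; elim: j => [|j IH]; first by rewrite mderivn0 subn0.
by rewrite mderivnS subnS; apply: dhomog_mderiv.
Qed.

Lemma mpoly_euler k (R : comNzRingType) n (p : {mpoly R[k]}) :
  p \is n.-homog -> \sum_i 'X_i * p^`M(i) = p *+ n.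
Proof.
move=> /dhomogP hp; rewrite {2}[p]mpolyE.
under eq_bigr => i _ do rewrite {1}[p]mpolyE !raddf_sum big_distrr /=.
rewrite exchange_big /= -sumrMnl !big_seq; apply: eq_bigr => m /hp /= <-.
under eq_bigr => i _.
  rewrite mderivZ mderivX -!scalerAr -mpolyXD.
  rewrite (_ : (m i)%:R *: _ = 'X_[m] *+ m i); first over.
  have [->|mi0] := eqVneq (m i) 0%N; first by rewrite scale0r mulr0n.
  by rewrite addmC submK ?scaler_nat // lep1mP.
by rewrite -scaler_sumr sumrMnr -scalerMnr [mdeg _]mdegE.
Qed.

Lemma mderivn1 k (R : nzRingType) (i : 'I_k) (f : {mpoly R[k]}) : f^`M(i, 1) = f^`M(i).
Proof. by rewrite mderivSn mderivn0. Qed.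

Lemma mderivXU k (R : nzRingType) (i j : 'I_k) :
  ('X_j : {mpoly R[k]})^`M(i) = (j == i)%:R%:MP.
Proof.
rewrite mderivX mnm1E; have [->|] := eqVneq j i; last by rewrite scale0r mpolyC0.
have ii : (U_(i) - U_(i) = 0)%MM by apply/mnmP=> x; rewrite mnmBE subnn mnm0E.
by rewrite ii mpolyX0 scale1r mpolyC1.
Qed.

(** Chain rule. Both sides are linear in [p] and satisfy the same Leibniz rule,
    so the formula spreads from the variables to all polynomials. *)
Lemma mderiv_comp k l (R : comNzRingType) (s : k.-tuple {mpoly R[l]}) i p :
  (p \mPo s)^`M(i) = \sum_j (p^`M(j) \mPo s) * (tnth s j)^`M(i).
Proof.
pose Q q := (q \mPo s)^`M(i) = \sum_j (q^`M(j) \mPo s) * (tnth s j)^`M(i).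
have QX j : Q 'X_j.
  rewrite /Q comp_mpolyXU -tnth_nth (bigD1 j) //= big1 ?addr0 => [|j' ne].
    by rewrite mderivXU eqxx comp_mpolyC mul1r.
  by rewrite mderivXU eq_sym (negPf ne) comp_mpolyC mul0r.
have Q1 : Q 1.
  rewrite /Q comp_mpoly1 -mpolyC1 mderivC big1 // => j _.
  by rewrite mderivC comp_mpoly0 mul0r.
have QM q1 q2 : Q q1 -> Q q2 -> Q (q1 * q2).
  rewrite /Q rmorphM /= mderivM => -> ->.
  rewrite big_distrl big_distrr -big_split /=; apply: eq_bigr => j _.
  rewrite mderivM comp_mpolyD !rmorphM /= mulrDl; congr (_ + _).
    by rewrite mulrAC.
  by rewrite mulrA.
have QXm m : Q 'X_[m].
  rewrite mpolyXE_id; apply: (big_ind Q Q1 QM) => j _.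
  elim: (m j) => [|d IH]; first exact: Q1.
  by rewrite exprS; apply: (QM _ _ (QX j)).
have Q0 : Q 0.
  rewrite /Q comp_mpoly0 mderiv0 big1 // => j _.
  by rewrite mderiv0 comp_mpoly0 mul0r.
have QD q1 q2 : Q q1 -> Q q2 -> Q (q1 + q2).
  rewrite /Q comp_mpolyD mderivD => -> ->; rewrite -big_split /=.
  by apply: eq_bigr => j _; rewrite mderivD comp_mpolyD mulrDl.
have QZ c q : Q q -> Q (c *: q).
  rewrite /Q comp_mpolyZ mderivZ => ->; rewrite scaler_sumr.
  by apply: eq_bigr => j _; rewrite mderivZ comp_mpolyZ scalerAl.
by rewrite -/(Q p) [p]mpolyE; apply: (big_ind Q Q0 QD) => m _; apply/QZ/QXm.
Qed.

(** * The curvature formulas under a linear change of parameters *)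

Section CurvatureFormulas.

Variables (F : fieldType) (m : F).

Definition kappa_den (i3 i4 : F) := 8 * (m - 3) * i3 + 3 * (m - 2) * i4 ^+ 2.

Definition kappa1_num (t0 t1 i1 i2 i3 i4 : F) :=
  8 * (m - 3) ^+ 2 * (t1 * i1 - t0 * i2) + 4 * (m - 1) * (m - 3) * t1 * i3 * i4
    + (m - 1) * (m - 2) * t1 * i4 ^+ 3.

Definition kappa2_num (t0 t1 i1 i2 i3 i4 : F) :=
  256 * (m - 3) ^+ 3 * i2 + 64 * (m - 3) ^+ 2 * (t1 * i1 - t0 * i2) * i4
    + 16 * (m - 1) * (m - 3) * t1 * i3 * i4 ^+ 2
    + 3 * (m - 1) * (m - 2) * t1 * i4 ^+ 4.

Variables (a b c d t0 t1 i1 i2 i3 i4 : F).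

Let U := a * t0 + b * t1.
Let V := c * t0 + d * t1.
Let delta := a * d - b * c.
Let rho := delta * t1 / V.
Let g := c / V.

(** The coefficients i_1, .., i_4 of the fourth derivative in the frame become
    [subst_I1], .., [subst_I4] under (t_0, t_1) |-> (U, V). Let x_k be the k-th derivative
    in the first variable composed with the substitution, and y_k the k-th
    t_0-derivative of the composite. The recursion of [mixed_deriv_rec] gives
      y_4 = rho^4 x_4 + 3 rho^3 g (m-3) x_3 + 3 rho^2 g^2 (m-2)(m-3) x_2
              + rho g^3 (m-1)(m-2)(m-3) x_1 + g (m-3) y_3,
    where x_4 is replaced by means of i_1, .., i_4; then x_3, x_2, x_1 are eliminated in
    this order in favour of y_3, y_2, y_1 and the t_1-derivative. Here
    rho^2 [subst_beta] is the coefficient of x_2 once x_3 is eliminated, and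
    rho [subst_alpha] that of x_1 once x_2 is eliminated. *)
Definition subst_alpha := rho ^+ 3 * i1 - g * (m - 1) * rho ^+ 2 * i3
  + g ^+ 2 * (m - 1) * (m - 2) * rho * i4
  + g ^+ 3 * (m - 1) * (m - 2) * (m - 3).
Definition subst_beta := rho ^+ 2 * i3 - 2 * g * rho * (m - 2) * i4
  - 3 * g ^+ 2 * (m - 2) * (m - 3).
Definition subst_I1 := t1 / V * (d * subst_alpha - b * rho ^+ 3 * i2)
  - g * (m - 1) * subst_beta.
Definition subst_I2 := t1 / V * (a * rho ^+ 3 * i2 - c * subst_alpha).
Definition subst_I3 := rho ^+ 2 * i3 - 3 * g * rho * (m - 2) * i4
  - 6 * g ^+ 2 * (m - 2) * (m - 3).
Definition subst_I4 := rho * i4 + 4 * g * (m - 3).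

(** The three building blocks of the curvatures are relative invariants of weights
    2, 3 and 4 for the factor rho, so that rho cancels in both curvatures. *)
Lemma kappa_den_reparam : kappa_den subst_I3 subst_I4 = rho ^+ 2 * kappa_den i3 i4.
Proof. by rewrite /kappa_den /subst_I3 /subst_I4; ring. Qed.

Hypothesis V0 : V != 0.

Lemma kappa1_num_reparam : kappa1_num t0 t1 subst_I1 subst_I2 subst_I3 subst_I4 / t1 =
  rho ^+ 3 * (kappa1_num U V i1 i2 i3 i4 / V).
Proof.
have [|t1N] := eqVneq t1 0.
  by rewrite /rho => ->; rewrite invr0 !(mulr0, mul0r) expr0n /= mul0r.
move: V0 t1N; rewrite /kappa1_num /subst_I1 /subst_I2 /subst_I3 /subst_I4.
rewrite /subst_alpha /subst_beta.
rewrite /rho /g /U /V /delta => *; field.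
by apply/andP; split.
Qed.

Lemma kappa2_num_reparam : kappa2_num t0 t1 subst_I1 subst_I2 subst_I3 subst_I4 / t1 =
  rho ^+ 4 * (kappa2_num U V i1 i2 i3 i4 / V).
Proof.
have [|t1N] := eqVneq t1 0.
  by rewrite /rho => ->; rewrite invr0 !(mulr0, mul0r) expr0n /= mul0r.
move: V0 t1N; rewrite /kappa2_num /subst_I1 /subst_I2 /subst_I3 /subst_I4.
rewrite /subst_alpha /subst_beta.
rewrite /rho /g /U /V /delta => *; field.
by apply/andP; split.
Qed.

Definition kappa1_formula (t0 t1 i1 i2 i3 i4 : F) :=
  kappa1_num t0 t1 i1 i2 i3 i4 ^+ 2 / (t1 ^+ 2 * kappa_den i3 i4 ^+ 3).

Definition kappa2_formula (t0 t1 i1 i2 i3 i4 : F) :=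
  kappa2_num t0 t1 i1 i2 i3 i4 / (t1 * kappa_den i3 i4 ^+ 2).

Hypotheses (delta0 : delta != 0) (t10 : t1 != 0).

Let rho0 : rho != 0.
Proof. by rewrite !mulf_neq0 ?invr_eq0. Qed.

Variables j1 j2 j3 j4 : F.
Hypotheses (j1E : j1 = subst_I1) (j2E : j2 = subst_I2).
Hypotheses (j3E : j3 = subst_I3) (j4E : j4 = subst_I4).

Lemma kappa1_formula_reparam :
  kappa1_formula t0 t1 j1 j2 j3 j4 = kappa1_formula U V i1 i2 i3 i4.
Proof.
rewrite j1E j2E j3E j4E.
have kE x t y : x ^+ 2 / (t ^+ 2 * y ^+ 3) = (x / t) ^+ 2 / y ^+ 3 :> F.
  by rewrite invfM mulrA expr_div_n.
rewrite /kappa1_formula !kE kappa1_num_reparam kappa_den_reparam.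
rewrite [(_ * (_ / _)) ^+ 2]exprMn [(_ * kappa_den _ _) ^+ 3]exprMn.
by rewrite -!exprM -mulf_div divff ?mul1r // expf_neq0.
Qed.

Lemma kappa2_formula_reparam :
  kappa2_formula t0 t1 j1 j2 j3 j4 = kappa2_formula U V i1 i2 i3 i4.
Proof.
rewrite j1E j2E j3E j4E.
have kE x t y : x / (t * y ^+ 2) = (x / t) / y ^+ 2 :> F.
  by rewrite invfM mulrA.
rewrite /kappa2_formula !kE kappa2_num_reparam kappa_den_reparam.
rewrite [(_ * kappa_den _ _) ^+ 2]exprMn -exprM.
by rewrite -mulf_div divff ?mul1r // expf_neq0.
Qed.

Variables x1 v1 x2 x3 x4 z11 z12 z13 z21 z22 z31 y1 s1 y2 y3 y4 : F.

(** Here z_(k,j) stands for the k-th t_0-derivative of the composite with the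
    substitution of the j-th derivative in the first variable; x_j = z_(0,j) and
    y_k = z_(k,0). The relations between them are those of [mixed_deriv_rec], and
    they make every z_(k,j) a combination of x_1, x_2, x_3, x_4 and v_1. *)
Lemma osculating_relation_reparam :
  y1 = a * x1 + c * v1 -> s1 = b * x1 + d * v1 ->
  V * y2 = delta * t1 * z11 + c * (m - 1) * y1 ->
  V * z11 = delta * t1 * x2 + c * (m - 1) * x1 ->
  V * y3 = delta * t1 * z21 + c * (m - 2) * y2 ->
  V * z21 = delta * t1 * z12 + c * (m - 2) * z11 ->
  V * z12 = delta * t1 * x3 + c * (m - 2) * x2 ->
  V * y4 = delta * t1 * z31 + c * (m - 3) * y3 ->
  V * z31 = delta * t1 * z22 + c * (m - 3) * z21 ->
  V * z22 = delta * t1 * z13 + c * (m - 3) * z12 ->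
  V * z13 = delta * t1 * x4 + c * (m - 3) * x3 ->
  x4 = i1 * x1 + i2 * v1 + i3 * x2 + i4 * x3 ->
  y4 = subst_I1 * y1 + subst_I2 * s1 + subst_I3 * y2 + subst_I4 * y3.
Proof.
have V1 x y : V * x = y -> x = y / V by move=> <-; rewrite mulrC mulKf.
move=> -> -> /V1-> /V1-> /V1-> /V1-> /V1-> /V1-> /V1-> /V1-> /V1-> ->.
move: V0 delta0 t10 => {V1}; rewrite /subst_I1 /subst_I2 /subst_I3 /subst_I4.
by rewrite /subst_alpha /subst_beta /rho /g /U /V /delta => *; field.
Qed.
End CurvatureFormulas.

Section CurvatureMorphism.
Variables (F F' : fieldType) (f : {rmorphism F -> F'}).

Lemma rmorph_kappa1_formula k (t0 t1 i1 i2 i3 i4 : F) :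
  f (kappa1_formula k%:R t0 t1 i1 i2 i3 i4)
    = kappa1_formula k%:R (f t0) (f t1) (f i1) (f i2) (f i3) (f i4).
Proof.
rewrite /kappa1_formula /kappa1_num /kappa_den fmorph_div.
by rewrite !(rmorphM, rmorphXn, rmorphB, rmorphD, rmorph_nat, rmorph1).
Qed.

Lemma rmorph_kappa2_formula k (t0 t1 i1 i2 i3 i4 : F) :
  f (kappa2_formula k%:R t0 t1 i1 i2 i3 i4)
    = kappa2_formula k%:R (f t0) (f t1) (f i1) (f i2) (f i3) (f i4).
Proof.
rewrite /kappa2_formula /kappa2_num /kappa_den fmorph_div.
by rewrite !(rmorphM, rmorphXn, rmorphB, rmorphD, rmorph_nat, rmorph1).
Qed.

End CurvatureMorphism.

(** * Evaluation of rational functions along a substitution *)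

Lemma fraction_reprE (D : idomainType) (x : {fraction D}) :
  x = tofrac (\n_(repr x)) / tofrac (\d_(repr x)).
Proof.
have d0 := denom_ratioP (repr x).
apply: (mulIf (_ : tofrac (\d_(repr x)) != 0)); first by rewrite tofrac_eq0.
rewrite divfK ?tofrac_eq0 // -{1}[x]reprK.
unlock FracField.tofrac; rewrite -[LHS]FracField.pi_mul; apply/eqmodP.
rewrite /= FracField.equivfE /FracField.mulf.
by rewrite !numden_Ratio ?(oner_neq0, mulf_neq0) // !mulr1 mulrC.
Qed.

Section Evalf.
Variable R : realType.
Notation P := {mpoly R[2]}.
Notation K := {fraction P}.

Lemma linsubst_inv (a b c d : R) (p : P) : a * d - b * c != 0 ->
  let e := (a * d - b * c)^-1 in
  (p \mPo linsubst a b c d) \mPo linsubst (e * d) (- (e * b)) (- (e * c)) (e * a)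
  = p.
Proof.
move=> det0 /=; set e := _^-1.
have eK : e * (a * d - b * c) = 1 by rewrite mulVf.
rewrite comp_mpolyA -[RHS]comp_mpoly_id; congr (_ \mPo _).
apply: eq_from_tnth => i; rewrite !tnth_mktuple.
case: i => -[|[|//]] lti /=; rewrite (tnth_nth 0) /=.
  rewrite comp_mpolyD !comp_mpolyZ !comp_mpolyXU /=.
  rewrite !scalerDr !scalerA addrACA -!scalerDl.
  rewrite (_ : a * _ + _ = 1); last by rewrite -eK; ring.
  rewrite (_ : a * _ + _ = 0); last by ring.
  by rewrite scale1r scale0r addr0; congr 'X_(_); apply: val_inj.
rewrite comp_mpolyD !comp_mpolyZ !comp_mpolyXU /=.
rewrite !scalerDr !scalerA addrACA -!scalerDl.
rewrite (_ : c * _ + _ = 0); last by ring.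
rewrite (_ : c * _ + _ = 1); last by rewrite -eK; ring.
by rewrite scale1r scale0r add0r; congr 'X_(_); apply: val_inj.
Qed.

Lemma linsubst_inj (a b c d : R) : a * d - b * c != 0 ->
  injective (@comp_mpoly 2 R 2 (linsubst a b c d)).
Proof. by move=> det0; apply: can_inj (fun p => linsubst_inv p det0). Qed.

Variable phi : 2.-tuple P.
Hypothesis phi_inj : injective (@comp_mpoly 2 R 2 phi).

Let comp_neq0 (z : P) : z != 0 -> tof (z \mPo phi) != 0.
Proof. by rewrite /tof tofrac_eq0 -(inj_eq phi_inj) comp_mpoly0. Qed.

Lemma evalf_frac (x y : P) : y != 0 ->
  evalf (tof x / tof y) phi = tof (x \mPo phi) / tof (y \mPo phi).
Proof.
move=> y0; rewrite /evalf; set f : K := tof x / tof y.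
have d0 := denom_ratioP (repr f).
apply/eqP; rewrite eqr_div ?comp_neq0 // /tof -!tofracM tofrac_eq -!rmorphM /=.
apply/eqP; congr (_ \mPo _).
apply/eqP; rewrite -tofrac_eq !tofracM -eqr_div ?tofrac_eq0 //.
by rewrite -fraction_reprE.
Qed.

(** An injective substitution extends to the fraction field, and this extension is
    [evalf]: its value does not depend on the chosen representative. *)
Lemma evalf_rmorphism : exists E : {rmorphism K -> K},
  (forall f, evalf f phi = E f) /\ (forall p : P, E (tof p) = tof (p \mPo phi)).
Proof.
pose e f := evalf f phi.
have eP (p : P) : e (tof p) = tof (p \mPo phi).
  have -> : tof p = tof p / tof 1 by rewrite /tof tofrac1 divr1.
  by rewrite /e evalf_frac ?oner_neq0 // comp_mpoly1 /tof tofrac1 divr1.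
have eB : zmod_morphism e.
  move=> f g; have df := denom_ratioP (repr f); have dg := denom_ratioP (repr g).
  rewrite [f]fraction_reprE [g]fraction_reprE; move: df dg.
  set nf := \n_(_); set ng := \n_(_).
  set df := \d_(_); set dg := \d_(_) => df0 dg0.
  rewrite -mulNr addf_div ?tofrac_eq0 // -tofracN -!tofracM -tofracD /e.
  rewrite !evalf_frac ?mulf_neq0 // /tof.
  rewrite !(comp_mpolyD, rmorphM, comp_mpolyN, rmorphN, rmorphD) /=.
  by rewrite -mulNr addf_div ?comp_neq0 //.
have eM : monoid_morphism e.
  split=> [|f g]; first by rewrite -tofrac1 eP comp_mpoly1.
  have df := denom_ratioP (repr f); have dg := denom_ratioP (repr g).
  rewrite [f]fraction_reprE [g]fraction_reprE; move: df dg.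
  set nf := \n_(_); set ng := \n_(_).
  set df := \d_(_); set dg := \d_(_) => df0 dg0.
  rewrite mulf_div -!tofracM /e !evalf_frac ?mulf_neq0 // mulf_div.
  by rewrite /tof !rmorphM.
exists (HB.pack_for {rmorphism K -> K} e (GRing.isZmodMorphism.Build K K e eB)
  (GRing.isMonoidMorphism.Build K K e eM)).
by split.
Qed.
End Evalf.

(** * Invariance of the curvatures under a linear change of parameters *)

(** Cramer's rule without division: the column j of B being A c, the expansion of
    det B along it is the j-th entry of (adj A) A c = (det A) c. *)
Lemma cramer_det (F : comNzRingType) k (A B : 'M[F]_k) (c : 'cV[F]_k) j :
  (forall l, l != j -> col l B = col l A) -> col j B = A *m c ->
  \det B = c j 0 * \det A.
Proof.
move=> BA Bj.
have -> : \det B = \sum_i (\adj A) j i * (A *m c) i 0.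
  rewrite (expand_det_col _ j); apply: eq_bigr => i _.
  rewrite -Bj !mxE mulrC; congr (_ * _); rewrite /cofactor; congr (_ * \det _).
  apply/matrixP => x y; rewrite !mxE.
  by have /colP/(_ (lift i x)) := BA (lift j y) (negbT (lift_eqF _ _)); rewrite !mxE.
have -> : \sum_i (\adj A) j i * (A *m c) i 0 = (\adj A *m (A *m c)) j 0.
  by rewrite mxE.
by rewrite mulmxA mul_adj_mx mul_scalar_mx mxE mulrC.
Qed.

Section Curvature.
Variable R : realType.
Notation P := {mpoly R[2]}.
Notation K := {fraction P}.
Notation "''t_0'" := ('X_(0 : 'I_2) : P).
Notation "''t_1'" := ('X_(1 : 'I_2) : P).

(** By Cramer's rule, the functions I_1, .., I_4 are the coordinates of the fourth
    derivative of u in the frame formed by the columns of D(u). This description,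
    unlike the quotients of determinants, is convenient to transform. *)
Definition osculating (u : 'cV[P]_4) (c1 c2 c3 c4 : K) := forall i,
  tof (pderiv 4 0 u i 0) = c1 * tof (pderiv 1 0 u i 0)
    + c2 * tof (pderiv 0 1 u i 0) + c3 * tof (pderiv 2 0 u i 0)
    + c4 * tof (pderiv 3 0 u i 0).

Lemma osculating_unique u c1 c2 c3 c4 : Delta u != 0 ->
  osculating u c1 c2 c3 c4 -> [/\ I1 u = c1, I2 u = c2, I3 u = c3 & I4 u = c4].
Proof.
move=> D0 osc.
have D0' : tof (Delta u) != 0 by rewrite /tof tofrac_eq0.
pose cs : 'cV[K]_4 := \col_j tnth [tuple c1; c2; c3; c4] j.
have wE i : tof (pderiv 4 0 u i 0) = (map_mx (@tof R) (Dmx u) *m cs) i 0.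
  rewrite osc [RHS]mxE !big_ord_recl big_ord0 !mxE !(tnth_nth 0) /=.
  by rewrite addr0 !addrA ![tof _ * _]mulrC.
have detE w1 w2 w3 w4 (j : 'I_4) :
    let B := map_mx (@tof R) (cols4 w1 w2 w3 w4) in
    (forall l, l != j -> col l B = col l (map_mx (@tof R) (Dmx u))) ->
    col j B = map_mx (@tof R) (pderiv 4 0 u) ->
  tof (\det (cols4 w1 w2 w3 w4)) / tof (Delta u) = cs j 0.
  move=> B BD Bj; rewrite -(mulfK D0' (cs j 0)); congr (_ / _).
  rewrite /tof /Delta -!det_map_mx; apply: cramer_det BD _.
  by rewrite Bj; apply/colP => i; rewrite -wE !mxE.
have csE (j : 'I_4) : cs j 0 = nth 0 [:: c1; c2; c3; c4] j.
  by rewrite mxE (tnth_nth 0).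
have off (j : 'I_4) (w1 w2 w3 w4 : 'cV[P]_4) :
    (forall l : 'I_4, l != j :> nat -> nth 0 [:: w1; w2; w3; w4] l =
       nth 0 [:: pderiv 1 0 u; pderiv 0 1 u; pderiv 2 0 u; pderiv 3 0 u] l) ->
    nth 0 [:: w1; w2; w3; w4] j = pderiv 4 0 u ->
  tof (\det (cols4 w1 w2 w3 w4)) / tof (Delta u) = nth 0 [:: c1; c2; c3; c4] j.
  move=> wD wj; rewrite -csE; apply: detE => [l lj|].
    by apply/colP => i; rewrite !mxE !(tnth_nth 0) /= wD.
  by apply/colP => i; rewrite !mxE (tnth_nth 0) /= wj mxE.
by split; [apply: (off (@Ordinal 4 0 isT)) | apply: (off (@Ordinal 4 1 isT))
         | apply: (off (@Ordinal 4 2 isT)) | apply: (off (@Ordinal 4 3 isT))] => //;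
  case=> -[|[|[|[|]]]].
Qed.

Lemma osculatingP u : Delta u != 0 -> osculating u (I1 u) (I2 u) (I3 u) (I4 u).
Proof.
move=> D0; pose D := map_mx (@tof R) (Dmx u).
have Du : D \in unitmx by rewrite unitmxE unitfE det_map_mx /= tofrac_eq0.
have [cs csE] : exists cs, map_mx (@tof R) (pderiv 4 0 u) = D *m cs.
  by exists (invmx D *m map_mx (@tof R) (pderiv 4 0 u)); rewrite mulKVmx.
have osc : osculating u (cs (@Ordinal 4 0 isT) 0) (cs (@Ordinal 4 1 isT) 0)
    (cs (@Ordinal 4 2 isT) 0) (cs (@Ordinal 4 3 isT) 0).
  move=> i; move/colP/(_ i): csE; rewrite [LHS]mxE => ->.
  rewrite [LHS]mxE !big_ord_recl big_ord0 addr0 !addrA /D !mxE.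
  rewrite ![tof _ * _]mulrC.
  by congr (_ * _ + _ * _ + _ * _ + _ * _); congr (cs _ _); apply: val_inj.
by case: (osculating_unique D0 osc) => -> -> -> ->.
Qed.

Lemma euler2 k (g : P) : g \is k.-homog ->
  't_0 * g^`M(0) + 't_1 * g^`M(1) = g *+ k.
Proof.
move=> /mpoly_euler <-; rewrite !big_ord_recl big_ord0 addr0.
by congr ('X_(_) * _^`M(_) + 'X_(_) * _^`M(_)); apply: val_inj.
Qed.

Section Reparametrization.
Variables (a b c d : R).
Let phi := linsubst a b c d.
Let V : P := c *: 't_0 + d *: 't_1.
Let delta := a * d - b * c.

Lemma mderiv_linsubst (g : P) (i : 'I_2) :
  (g \mPo phi)^`M(i) = (if i == 0 then a else b) *: (g^`M(0) \mPo phi)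
    + (if i == 0 then c else d) *: (g^`M(1) \mPo phi).
Proof.
have lin x y : (x *: 't_0 + y *: 't_1)^`M(i) = (if i == 0 then x else y)%:MP.
  rewrite mderivD !mderivZ !mderivXU -!mul_mpolyC -!mpolyCM -mpolyCD.
  by case: i => -[|[|//]] lti; rewrite /= !(mulr0, mulr1, addr0, add0r).
rewrite mderiv_comp !big_ord_recl big_ord0 addr0 !(tnth_nth 0) /= !lin.
rewrite !(mulrC _ _%:MP) !mul_mpolyC.
by congr (_ *: (_^`M(_) \mPo _) + _ *: (_^`M(_) \mPo _)); apply: val_inj.
Qed.

Lemma comp_linsubst1 : 't_1 \mPo phi = V.
Proof. by rewrite comp_mpolyXU. Qed.

Lemma comp_linsubst0 : 't_0 \mPo phi = a *: 't_0 + b *: 't_1.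
Proof. by rewrite comp_mpolyXU. Qed.

(** The derivative of g o phi in t_0 is a g_U + c g_V, and Euler's relation
    U g_U + V g_V = k g eliminates g_V once this is multiplied by V. *)
Lemma mderiv_linsubst_euler k (g : P) : g \is k.-homog ->
  V * (g \mPo phi)^`M(0)
    = delta *: ('t_1 * (g^`M(0) \mPo phi)) + (c * k%:R) *: (g \mPo phi).
Proof.
move=> /euler2 /(congr1 (comp_mpoly phi)).
rewrite mderiv_linsubst /= rmorphMn rmorphD !rmorphM /= comp_linsubst0 comp_linsubst1.
rewrite -scaler_nat => e; rewrite -scalerA -e.
rewrite /V /delta -!mul_mpolyC !rmorphB !rmorphM /=.
ring.
Qed.

(** These derivatives suffice to follow the first variable through the substitution:
    thanks to Euler's relation no derivative in the second variable occurs. *)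
Definition mixed_deriv k j (f : P) : P := (f^`M(0, j) \mPo phi)^`M(0, k).

(** Differentiating [mderiv_linsubst_euler] k times in t_0. Each differentiation
    of the left-hand side adds the derivative c of V, hence the term - k. *)
Lemma mixed_deriv_rec n k j (f : P) : f \is n.-homog -> (j <= n)%N ->
  V * mixed_deriv k.+1 j f = delta *: ('t_1 * mixed_deriv k j.+1 f)
    + (c * (n%:R - j%:R - k%:R)) *: mixed_deriv k j f.
Proof.
move=> hf le_jn; elim: k => [|k IH].
  rewrite /mixed_deriv mderivn1 !mderivn0 mderivnS subr0 -natrB //.
  exact: mderiv_linsubst_euler (dhomog_mderivn _ _ hf).
have V1 : V^`M(0) = c%:MP.
  rewrite mderivD !mderivZ !mderivXU /= scaler0 addr0.
  by rewrite -mul_mpolyC mulr1.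
move/(congr1 (mderiv 0)): IH; rewrite mderivM V1 mderivD !mderivZ mderivM.
rewrite mderivXU mul0r add0r -!mderivnS => /eqP.
rewrite addrC -subr_eq => /eqP <-.
rewrite /mixed_deriv -natr1 -!mul_mpolyC !(mpolyCM, mpolyCB, mpolyC1, mpolyCD).
by ring.
Qed.

Variables (n : nat) (q : 'cV[P]_4).
Hypotheses (n4 : (4 <= n)%N) (hq : homogeneous n q) (delta0 : delta != 0).
Hypotheses (Dq : Delta q != 0) (Dqphi : Delta (compv q phi) != 0).

Let C x : K := tof (x%:MP).

Lemma I_compv (E : {rmorphism K -> K}) :
  (forall p : P, E (tof p) = tof (p \mPo phi)) ->
  let at_q J := J n%:R (C a) (C b) (C c) (C d) (tof 't_0) (tof 't_1)
    (E (I1 q)) (E (I2 q)) (E (I3 q)) (E (I4 q)) in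
  [/\ I1 (compv q phi) = at_q (@subst_I1 K), I2 (compv q phi) = at_q (@subst_I2 K),
      I3 (compv q phi) = subst_I3 n%:R (C a) (C b) (C c) (C d) (tof 't_0) (tof 't_1)
        (E (I3 q)) (E (I4 q))
    & I4 (compv q phi) = subst_I4 n%:R (C a) (C b) (C c) (C d) (tof 't_0) (tof 't_1)
        (E (I4 q))].
Proof.
move=> EP at_q; apply: osculating_unique => // i.
have hf := hq i; set f := q i 0 in hf.
have tofZ x p : tof (x *: p) = C x * tof p by rewrite -mul_mpolyC /tof tofracM.
have tofM x y : tof (x * y) = tof x * tof y := tofracM x y.
have tofD x y : tof (x + y) = tof x + tof y := tofracD x y.
have tofB x y : tof (x - y) = tof x - tof y := tofracB x y.
have VE : tof V = C c * tof 't_0 + C d * tof 't_1.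
  by rewrite -!tofZ /tof -tofracD.
have X1 : 't_1 != 0 by rewrite -msize_poly_eq0 msizeX.
have Vne : tof V != 0.
  rewrite /tof -comp_linsubst1 tofrac_eq0 -(rmorph0 (comp_mpoly phi)).
  by rewrite (inj_eq (linsubst_inj delta0)).
have dE : tof (delta%:MP) = C a * C d - C b * C c.
  by rewrite /C /tof -!tofracM -tofracB -!rmorphM -rmorphB.
have zE k j : (j <= n)%N ->
  tof V * tof (mixed_deriv k.+1 j f) =
    (C a * C d - C b * C c) * tof 't_1 * tof (mixed_deriv k j.+1 f)
    + C (c * (n%:R - j%:R - k%:R)) * tof (mixed_deriv k j f).
  move=> /(mixed_deriv_rec k hf) /(congr1 (@tof R)).
  rewrite tofM [tof (_ + _ *: mixed_deriv k j f)]tofD !tofZ tofM -dE mulrA.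
  exact.
have Cn k m : (c * (n%:R - k%:R - m%:R)) = c * (n%:R - (k + m)%:R).
  by rewrite -addrA -opprD -natrD.
have nB k : C (c * (n%:R - k%:R)) = C c * (n%:R - k%:R).
  by rewrite /C mpolyCM mpolyCB !mpolyC_nat tofM tofB /tof !rmorph_nat.
have XE j : E (tof f^`M(0, j)) = tof (mixed_deriv 0 j f).
  by rewrite EP /mixed_deriv mderivn0.
have pE k l : pderiv k l q i 0 = f^`M(0, k)^`M(1, l) by rewrite mxE.
have pcE k : pderiv k 0 (compv q phi) i 0 = mixed_deriv k 0 f.
  by rewrite /mixed_deriv !mxE !mderivn0.
have osc : E (tof f^`M(0, 4)) = E (I1 q) * E (tof f^`M(0, 1))
    + E (I2 q) * E (tof f^`M(1)) + E (I3 q) * E (tof f^`M(0, 2))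
    + E (I4 q) * E (tof f^`M(0, 3)).
  have /(congr1 E) := osculatingP Dq i.
  rewrite !pE !mderivn0 [f^`M(1, 1)]mderivn1 => ->.
  by move: (I1 q) (I2 q) (I3 q) (I4 q) => ? ? ? ?; rewrite !rmorphD !rmorphM.
have y1E : tof (mixed_deriv 1 0 f) =
    C a * tof (mixed_deriv 0 1 f) + C c * E (tof f^`M(1)).
  by rewrite EP -!tofZ -tofD /mixed_deriv !mderivn1 !mderivn0 mderiv_linsubst.
have s1E : tof (pderiv 0 1 (compv q phi) i 0)
    = C b * tof (mixed_deriv 0 1 f) + C d * E (tof f^`M(1)).
  by rewrite EP -!tofZ -tofD /mixed_deriv !mxE !mderivn1 !mderivn0 mderiv_linsubst.
rewrite !pcE /at_q.
have le k : (k <= 4)%N -> (k <= n)%N by move=> /leq_trans; apply.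
have z k j m : (j <= 4)%N -> (j + k)%N = m ->
    tof V * tof (mixed_deriv k.+1 j f) =
      (C a * C d - C b * C c) * tof 't_1 * tof (mixed_deriv k j.+1 f)
      + C c * (n%:R - m%:R) * tof (mixed_deriv k j f).
  by move=> /le /(zE k) -> <-; rewrite Cn nB.
rewrite VE in z Vne.
have t1ne : tof 't_1 != 0 by rewrite /tof tofrac_eq0.
have dne : C a * C d - C b * C c != 0 by rewrite -dE /tof tofrac_eq0 mpolyC_eq0.
apply: (osculating_relation_reparam Vne dne t1ne y1E s1E
  (z 1 0 1 isT erefl) (z 0 1 1 isT erefl)
  (z 2 0 2 isT erefl) (z 1 1 2 isT erefl) (z 0 2 2 isT erefl)
  (z 3 0 3 isT erefl) (z 2 1 3 isT erefl) (z 1 2 3 isT erefl) (z 0 3 3 isT erefl)).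
by rewrite -!XE.
Qed.

Lemma kappa1E k (u : 'cV[P]_4) :
  kappa1 k u = kappa1_formula k%:R (tof 't_0) (tof 't_1) (I1 u) (I2 u) (I3 u) (I4 u).
Proof. by []. Qed.

Lemma kappa2E k (u : 'cV[P]_4) :
  kappa2 k u = kappa2_formula k%:R (tof 't_0) (tof 't_1) (I1 u) (I2 u) (I3 u) (I4 u).
Proof. by []. Qed.

(** The new coordinates I_j are the [subst_I1], .., [subst_I4] of the old ones, and
    the rational expressions of the curvatures are invariant under this change. *)
Lemma kappa_compv : kappa1 n (compv q phi) = evalf (kappa1 n q) phi /\
  kappa2 n (compv q phi) = evalf (kappa2 n q) phi.
Proof.
have [E [evE EP]] := evalf_rmorphism (linsubst_inj delta0).
have [e1 e2 e3 e4] := I_compv EP.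
have Et (x y : R) : tof (x *: 't_0 + y *: 't_1) = C x * tof 't_0 + C y * tof 't_1.
  by rewrite /tof tofracD -!mul_mpolyC !tofracM.
have E0 : E (tof 't_0) = C a * tof 't_0 + C b * tof 't_1.
  by rewrite EP comp_linsubst0 Et.
have E1 : E (tof 't_1) = C c * tof 't_0 + C d * tof 't_1.
  by rewrite EP comp_linsubst1 Et.
have X1 : 't_1 != 0 by rewrite -msize_poly_eq0 msizeX.
have Vne : C c * tof 't_0 + C d * tof 't_1 != 0.
  by rewrite -E1 fmorph_eq0 /tof tofrac_eq0.
have t1ne : tof 't_1 != 0 by rewrite /tof tofrac_eq0.
have dne : C a * C d - C b * C c != 0.
  by rewrite /C /tof -!tofracM -tofracB -!rmorphM -rmorphB tofrac_eq0 mpolyC_eq0.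
have k1E : E (kappa1 n q) = kappa1_formula n%:R (E (tof 't_0)) (E (tof 't_1))
    (E (I1 q)) (E (I2 q)) (E (I3 q)) (E (I4 q)).
  rewrite (kappa1E n q); move: (I1 q) (I2 q) (I3 q) (I4 q) => *.
  exact: rmorph_kappa1_formula.
have k2E : E (kappa2 n q) = kappa2_formula n%:R (E (tof 't_0)) (E (tof 't_1))
    (E (I1 q)) (E (I2 q)) (E (I3 q)) (E (I4 q)).
  rewrite (kappa2E n q); move: (I1 q) (I2 q) (I3 q) (I4 q) => *.
  exact: rmorph_kappa2_formula.
rewrite !evE k1E k2E E0 E1 (kappa1E n (compv q phi)) (kappa2E n (compv q phi)).
split.
  exact: (kappa1_formula_reparam Vne dne t1ne e1 e2 e3 e4).
exact: (kappa2_formula_reparam Vne dne t1ne e1 e2 e3 e4).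
Qed.
End Reparametrization.
End Curvature.

(** * Wronskians of univariate polynomials *)

Section TopCoef.
Variable R : comNzRingType.
Implicit Types p q : {poly R}.

(** [a] is only an upper bound for the degree: the coefficient [c] may vanish. *)
Definition has_top a p c := (size p <= a.+1)%N /\ p`_a = c.

Lemma has_top1 : has_top 0 1 1.
Proof. by rewrite /has_top size_poly1 coef1. Qed.

Lemma has_topM a b p q c d :
  has_top a p c -> has_top b q d -> has_top (a + b) (p * q) (c * d).
Proof.
move=> [sp pa] [sq qb]; split.
  apply: leq_trans (size_polyMleq p q) _; rewrite -subn1 leq_subLR add1n.
  by apply: leq_trans (leq_add sp sq) _; rewrite addSn addnS.
rewrite coefM (bigD1 (Ordinal (leq_addr b a : (a < (a + b).+1)%N))) //= addKn pa qb.
rewrite big1 ?addr0 // => -[i lti]; rewrite -val_eqE /= => ia.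
have [lt_ia|le_ai] := ltnP i a.
  rewrite (nth_default _ (_ : (size q <= a + b - i)%N)) ?mulr0 //.
  apply: leq_trans sq _; rewrite -addnBAC ?(ltnW lt_ia) //.
  by rewrite -addn1 addnC leq_add2r subn_gt0.
rewrite (nth_default _ (_ : (size p <= i)%N)) ?mul0r //.
by apply: leq_trans sp _; rewrite ltn_neqAle eq_sym ia.
Qed.

Lemma has_top_prod (I : finType) (d : I -> nat) (p : I -> {poly R}) c :
  (forall i, has_top (d i) (p i) (c i)) ->
  has_top (\sum_i d i) (\prod_i p i) (\prod_i c i).
Proof.
move=> top; elim/big_rec3: _ => [|i x y z _ IH]; first exact: has_top1.
exact: has_topM.
Qed.

(** In the Leibniz formula each product takes one entry of every row, so that
    only the coefficients of maximal degree contribute in degree \sum_i d_i. *)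
Lemma coef_det_top n (M : 'M[{poly R}]_n) (d : 'I_n -> nat) :
  (forall i j, size (M i j) <= (d i).+1)%N ->
  (\det M)`_(\sum_i d i) = \det (\matrix_(i, j) (M i j)`_(d i)).
Proof.
move=> sM; rewrite /determinant coef_sum; apply: eq_bigr => s _.
have top i : has_top (d i) (M i (s i)) (M i (s i))`_(d i) by split.
have [_] := has_top_prod top; case: (odd_perm s) => /=.
  rewrite !expr1 !mulN1r coefN => ->.
  by congr (- _); apply: eq_bigr => i _; rewrite mxE.
by rewrite !expr0 !mul1r => ->; apply: eq_bigr => i _; rewrite mxE.
Qed.
End TopCoef.

Section Theta.
Variable R : comNzRingType.
Implicit Types f : {poly R}.

(** Unlike the derivation itself, x d/dx acts diagonally on monomials, with
    eigenvalues the degrees: it turns a Wronskian into a Vandermonde determinant. *)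
Definition theta f := 'X * f^`().

Lemma coef_iter_theta j f k : (iter j theta f)`_k = f`_k * k%:R ^+ j.
Proof.
elim: j => [|j IH]; first by rewrite mulr1.
rewrite iterS /theta coefXM; case: k IH => [|k] IH; first by rewrite expr0n mulr0.
by rewrite /= coef_deriv IH exprSr mulrA mulr_natr.
Qed.

Lemma size_iter_theta j f : (size (iter j theta f) <= size f)%N.
Proof. by apply/leq_sizeP => k kf; rewrite coef_iter_theta nth_default ?mul0r. Qed.

(** (x d/dx)^j = \sum_k S(j,k) x^k (d/dx)^k with Stirling numbers S(j,k). Only the
    triangular shape matters, so the recursion coming from the Leibniz rule is
    used as the definition. *)
Fixpoint theta_coef (j k : nat) : {poly R} :=
  match j with
  | 0 => (k == 0)%N%:R
  | j.+1 => 'X * (theta_coef j k)^`()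
            + (if k is k.+1 then 'X * theta_coef j k else 0)
  end.

Lemma theta_coef_gt j k : (j < k)%N -> theta_coef j k = 0.
Proof.
elim: j k => [|j IH] [|k] //= jk; rewrite !IH ?(ltnW jk) //.
by rewrite deriv0 !mulr0 addr0.
Qed.

Lemma iter_theta n j f : (j < n)%N ->
  iter j theta f = \sum_(k < n) theta_coef j k * f^`(k).
Proof.
case: n => // n; elim: j => [|j IH] jn.
  by rewrite big_ord_recl mul1r big1 ?addr0 // => i _; rewrite mul0r.
rewrite iterS IH ?(ltnW jn) // /theta raddf_sum /= big_distrr /=.
under eq_bigr => k _ do rewrite derivM -derivnS mulrDr !mulrA.
under [RHS]eq_bigr => k _ do rewrite mulrDl.
rewrite !big_split /=; congr (_ + _).
rewrite big_ord_recr [in RHS]big_ord_recl /= (theta_coef_gt (_ : j < n)%N) //.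
by rewrite mulr0 !mul0r addr0 add0r.
Qed.
End Theta.

Section Wronskian.
Variable R : numFieldType.

Definition wronskian_mx n (f : 'cV[{poly R}]_n) : 'M[{poly R}]_n :=
  \matrix_(i, j) (f i 0)^`(j).

Definition lin_indep n (f : 'cV[{poly R}]_n) :=
  forall h : 'rV[R]_n, map_mx polyC h *m f = 0 -> h = 0.

(** The matrix of the (x d/dx)^j f_i is a multiple of the Wronskian matrix, and the
    coefficient of its determinant in degree \sum_i deg f_i is the product of the
    leading coefficients of the f_i and a Vandermonde determinant in their degrees. *)
Lemma wronskian_distinct_size n (f : 'cV[{poly R}]_n) :
  (forall i, f i 0 != 0) -> injective (fun i => size (f i 0)) ->
  \det (wronskian_mx f) != 0.
Proof.
move=> f0 injf; pose d i := (size (f i 0)).-1.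
have szE i : (d i).+1 = size (f i 0) by rewrite prednK ?size_poly_gt0.
pose Th : 'M[{poly R}]_n := \matrix_(i, j) iter j (@theta R) (f i 0).
have ThE : Th = wronskian_mx f *m \matrix_(k, j) theta_coef R j k.
  apply/matrixP => i j; rewrite !mxE (iter_theta _ (ltn_ord j)).
  by apply: eq_bigr => k _; rewrite !mxE mulrC.
suff: \det Th != 0 by rewrite ThE det_mulmx mulf_eq0 negb_or => /andP[].
have sTh i j : (size (Th i j) <= (d i).+1)%N.
  by rewrite mxE szE; apply: size_iter_theta.
have coefTh : \matrix_(i, j) (Th i j)`_(d i) =
    diag_mx (\row_i lead_coef (f i 0)) *m (Vandermonde n (\row_i (d i)%:R))^T.
  by apply/matrixP => i j; rewrite mul_diag_mx !mxE coef_iter_theta.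
apply/eqP => Th0; move/esym/eqP: (coef_det_top sTh).
rewrite Th0 coef0 coefTh det_mulmx det_diag det_tr det_Vandermonde.
rewrite mulf_eq0 => /orP[]; apply/negP.
  by apply/prodf_neq0 => i _; rewrite mxE lead_coef_eq0.
apply/prodf_neq0 => i _; apply/prodf_neq0 => j ij.
rewrite !mxE subr_eq0 eqr_nat; apply: contraTneq ij => dij.
have -> : j = i by apply: injf; rewrite -!szE dij.
by rewrite ltnn.
Qed.

(** If two of the polynomials have the same degree, subtracting a multiple of one
    from the other lowers the degree, keeps the family independent and
    multiplies the Wronskian by a constant; so one may assume distinct degrees. *)
Lemma wronskian_neq0 n (f : 'cV[{poly R}]_n) :
  lin_indep f -> \det (wronskian_mx f) != 0.
Proof.
have [N leN] := ubnP (\sum_i size (f i 0)%R).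
elim: N f leN => // N IH f leN indf.
have f0 i : f i 0 != 0.
  apply/eqP => fi0; have := indf (delta_mx 0 i).
  rewrite map_delta_mx -rowE; have /[swap]/[apply] : row i f = 0.
    by apply/rowP => k; rewrite !mxE !ord1 fi0.
  by move/rowP/(_ i)/eqP; rewrite !mxE !eqxx oner_eq0.
have [/injectiveP injf|] := boolP (injectiveb (fun i => size (f i 0))).
  exact: wronskian_distinct_size.
case/injectivePn => i [j ij sij].
pose r := lead_coef (f i 0) / lead_coef (f j 0).
pose E : 'M[R]_n := 1%:M - r *: delta_mx i j.
pose g := map_mx polyC E *m f.
have gE k : g k 0 = f k 0 - (if k == i then r *: f j 0 else 0).
  rewrite /g /E map_mxB mulmxBl map_mx1 mul1mx map_mxZ map_delta_mx mxE; congr (_ + _).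
  rewrite mxE; congr (- _).
  rewrite -scalemxAl mxE mxE (bigD1 j) //= big1 => [|l lj].
    rewrite !mxE eqxx andbT addr0; case: eqP => _;
      by rewrite ?mul1r ?mul0r ?mulr0 // mul_polyC.
  by rewrite !mxE (negPf lj) andbF mul0r.
have Wg : wronskian_mx g = map_mx polyC E *m wronskian_mx f.
  apply/matrixP => k l; rewrite !mxE raddf_sum; apply: eq_bigr => x _.
  by rewrite [in RHS]mxE [in LHS]mxE /= !mul_polyC derivnZ !mxE.
suff: \det (wronskian_mx g) != 0.
  by rewrite Wg det_mulmx mulf_eq0 negb_or => /andP[].
apply: IH.
  rewrite -ltnS; apply: leq_trans leN; rewrite ltnS.
  rewrite (bigD1 i) //= [X in (_ < X)%N](bigD1 i) //= -addSn leq_add //.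
    rewrite gE eqxx -[size (f i 0)]prednK ?size_poly_gt0 // ltnS.
    apply/leq_sizeP => k; rewrite leq_eqVlt coefB coefZ => /predU1P[<-|].
      by rewrite {2}sij /r /lead_coef divfK ?subrr // lead_coef_eq0.
    rewrite prednK ?size_poly_gt0 // => sk.
    by rewrite !nth_default -?sij // mulr0 subrr.
  by apply: leq_sum => k ki; rewrite gE (negPf ki) subr0.
move=> h; rewrite mulmxA -map_mxM => /indf hE.
have hk k : h 0 k = if k == j then r * h 0 i else 0.
  move/rowP/(_ k): hE; rewrite mulmxBr mulmx1 -scalemxAr !mxE => /eqP.
  rewrite subr_eq0 => /eqP ->.
  rewrite (bigD1 i) //= big1 => [|l li]; rewrite !mxE ?eqxx ?(negPf li) ?mulr0 //=.
  by rewrite addr0; case: eqP => _; rewrite ?mulr1 ?mulr0.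
have hi : h 0 i = 0 by rewrite hk (negPf ij).
by apply/rowP => k; rewrite hk hi mulr0 mxE if_same.
Qed.
End Wronskian.

(** * Binary forms and their dehomogenizations *)

Section Dehomogenization.
Variable R : comNzRingType.
Notation P := {mpoly R[2]}.
Implicit Types (p : P) (f g h s : {poly R}).

Definition horner2 f g p : {poly R} := mmap (@polyC R) (tnth [tuple f; g]) p.
HB.instance Definition _ f g := GRing.RMorphism.copy (horner2 f g)
  (mmap (@polyC R) (tnth [tuple f; g])).

Lemma horner2C f g c : horner2 f g c%:MP = c%:P.
Proof. exact: mmapC. Qed.

Lemma horner2Z f g c p : horner2 f g (c *: p) = c *: horner2 f g p.
Proof. by rewrite -mul_mpolyC rmorphM /= horner2C mul_polyC. Qed.

Lemma horner2X f g i : horner2 f g 'X_i = tnth [tuple f; g] i.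
Proof. by rewrite /horner2 mmapX mmap1U. Qed.

Lemma horner2Xm f g m : horner2 f g 'X_[m] = f ^+ m 0 * g ^+ m 1.
Proof.
rewrite /horner2 mmapX /mmap1 !big_ord_recl big_ord0 mulr1.
by congr (_ ^+ m _ * _ ^+ m _); apply: val_inj.
Qed.

Lemma horner_horner2 f g p x :
  (horner2 f g p).[x] = p.@[tnth [tuple f.[x]; g.[x]]].
Proof.
pose e : {rmorphism P -> R} := horner_eval x \o horner2 f g.
rewrite -[LHS]/(e p); apply: mpoly_rmorph_eq => [c|i] /=.
  by rewrite horner2C /horner_eval hornerC mevalC.
by rewrite horner2X /horner_eval mevalXU; case: i => -[|[|//]] lti.
Qed.

Lemma horner2_comp f g p (s : 2.-tuple P) :
  horner2 f g (p \mPo s) = horner2 (horner2 f g (tnth s 0)) (horner2 f g (tnth s 1)) p.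
Proof.
pose e : {rmorphism P -> {poly R}} := horner2 f g \o comp_mpoly s.
rewrite -[LHS]/(e p); apply: mpoly_rmorph_eq => [c|i] /=.
  by rewrite comp_mpolyC !horner2C.
rewrite comp_mpolyXU -tnth_nth horner2X; case: i => -[|[|//]] lti.
  by rewrite [RHS](tnth_nth 0) /=; congr (horner2 _ _ (tnth _ _)); apply: val_inj.
by rewrite [RHS](tnth_nth 0) /=; congr (horner2 _ _ (tnth _ _)); apply: val_inj.
Qed.

Lemma horner2_homog f g h n p : p \is n.-homog ->
  horner2 (h * f) (h * g) p = h ^+ n * horner2 f g p.
Proof.
move=> /(mmap_homog (polyC : {rmorphism R -> {poly R}}) (tnth [tuple f; g]) h) <-.
rewrite /horner2 /mmap; apply: eq_bigr => m _; congr (_ * _).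
apply: eq_bigr => i _; congr (_ ^+ _).
by case: i => -[|[|//]] lti; rewrite !(tnth_nth 0).
Qed.

(** Binary forms of a fixed degree are handled through this isomorphism with
    univariate polynomials of bounded degree, which live in a principal ideal
    domain. *)
Definition dehom p := horner2 'X 1 p.
HB.instance Definition _ := GRing.RMorphism.copy dehom (horner2 'X 1).

Definition homogenize n s : P := \sum_(k < n.+1) s`_k *: ('X_0 ^+ k * 'X_1 ^+ (n - k)).

Lemma homogenize_is_linear n : linear (homogenize n).
Proof.
move=> c s t; rewrite /homogenize scaler_sumr -big_split /=; apply: eq_bigr => k _.
by rewrite coefD coefZ scalerDl scalerA.
Qed.
HB.instance Definition _ n :=
  GRing.isLinear.Build R {poly R} P *:%R (homogenize n) (homogenize_is_linear n).

Lemma mpolyX2 (m : 'X_{1..2}) : 'X_[m] = 'X_0 ^+ m 0 * 'X_1 ^+ m 1 :> P.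
Proof.
rewrite mpolyXE_id !big_ord_recl big_ord0 mulr1.
by congr ('X_(_) ^+ m _ * 'X_(_) ^+ m _); apply: val_inj.
Qed.

Lemma mdeg2 (m : 'X_{1..2}) : mdeg m = (m 0%R + m 1%R)%N.
Proof.
rewrite mdegE !big_ord_recl big_ord0 addn0.
by congr (m _ + m _)%N; apply: val_inj.
Qed.

Lemma dhomog_homogenize n s : homogenize n s \is n.-homog.
Proof.
have hX (i : 'I_2) d : ('X_i : P) ^+ d \is d.-homog.
  by rewrite -{2}[d]mul1n; apply: dhomogMn; rewrite dhomogX /= mdeg1.
apply: rpred_sum => k _; apply: dhomogZ.
by rewrite -[X in X.-homog](subnKC (leq_ord k)); apply: dhomogM.
Qed.

Lemma dehomK n p : p \is n.-homog -> homogenize n (dehom p) = p.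
Proof.
move=> /dhomogP hp; rewrite [p]mpolyE /dehom (raddf_sum (horner2 'X 1)).
rewrite (raddf_sum (homogenize n)) /= !big_seq.
apply: eq_bigr => m /hp /= dm; rewrite horner2Z linearZ /=; congr (_ *: _).
have le_mn : (m 0%R < n.+1)%N by rewrite -dm mdeg2 ltnS leq_addr.
rewrite horner2Xm expr1n mulr1 /homogenize (bigD1 (Ordinal le_mn)) //= big1 => [|k ne].
  rewrite coefXn eqxx scale1r addr0 [RHS]mpolyX2; congr (_ * _ ^+ _).
  by rewrite -dm mdeg2 addKn.
rewrite coefXn [_ == _](negPf _) ?scale0r //.
Qed.

Lemma dehom_inj n : {in [in R[2], n.-homog] &, injective dehom}.
Proof. by move=> p q hp hq e; rewrite -(dehomK hp) e (dehomK hq). Qed.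

Lemma size_dehom n p : p \is n.-homog -> (size (dehom p) <= n.+1)%N.
Proof.
move=> /dhomogP hp; rewrite /dehom [p]mpolyE (raddf_sum (horner2 'X 1)) /= big_seq.
apply/leq_sizeP => k nk; rewrite coef_sum big1 // => m /hp /= dm.
rewrite horner2Z horner2Xm expr1n mulr1 coefZ coefXn gtn_eqF ?mulr0 //.
by apply: leq_trans nk; rewrite -dm mdeg2 ltnS leq_addr.
Qed.

Lemma horner2_homogenize f g n s :
  horner2 f g (homogenize n s) = \sum_(k < n.+1) s`_k *: (f ^+ k * g ^+ (n - k)).
Proof.
rewrite raddf_sum; apply: eq_bigr => k _.
by rewrite /= horner2Z rmorphM !rmorphXn /= !horner2X.
Qed.

Lemma homogenizeK n s : (size s <= n.+1)%N -> dehom (homogenize n s) = s.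
Proof.
move=> ss; rewrite /dehom horner2_homogenize; under eq_bigr do rewrite expr1n mulr1.
rewrite -[RHS]coefK poly_def (big_ord_widen n.+1 (fun k => s`_k *: 'X^k) ss).
rewrite [RHS]big_mkcond /=; apply: eq_bigr => k _.
by case: ltnP => // sk; rewrite nth_default ?scale0r.
Qed.

Lemma dehom_mderiv0 p : dehom p^`M(0) = (dehom p)^`().
Proof.
rewrite [p]mpolyE /dehom (raddf_sum (mderiv 0)) !(raddf_sum (horner2 'X 1)).
rewrite (raddf_sum (@deriv R)) /=.
apply: eq_bigr => m _.
rewrite mderivZ !horner2Z derivZ; congr (_ *: _).
rewrite mderivX horner2Z !horner2Xm !expr1n !mulr1 derivXn mnmBE mnm1E /= subn1.
by rewrite scaler_nat.
Qed.

End Dehomogenization.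

Section DeltaNeq0.
Variable R : realType.
Notation P := {mpoly R[2]}.

(** A linear relation between the components of u is a hyperplane containing all the
    points u(t), hence containing the Zariski closure. *)
Lemma curve_spans (u : 'cV[P]_4) (h : 'rV[R]_4) : ~ in_hyperplane (curve u) ->
  map_mx (@mpolyC 2 R) h *m u = 0 -> h = 0.
Proof.
move=> nh hu; apply/eqP/negPn/negP => h0; apply: nh; exists h => // x [_].
pose F : {mpoly R[4]} := \sum_i h 0 i *: 'X_i.
have FE v : F.@[v] = \sum_i h 0 i * v i.
  by rewrite /F (raddf_sum (meval v)); apply: eq_bigr => i _; rewrite /= mevalZ mevalXU.
move/(_ 1%N F) => Fx; apply/matrixP => i j; rewrite !ord1 [RHS]mxE mxE -FE.
apply: Fx.
  by apply: rpred_sum => k _; apply: dhomogZ; rewrite dhomogX /= mdeg1.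
move=> t _; rewrite FE.
move/matrixP/(_ 0 0)/(congr1 (meval (fun i => t i 0))): hu.
rewrite !mxE meval0 (raddf_sum (meval _)) /= => e; rewrite -[RHS]e.
apply: eq_bigr => k _.
by rewrite !mxE mevalM mevalC.
Qed.

(** Up to the factor n, Euler's relation replaces the derivative of u in t_1 by
    u itself modulo its derivative in t_0, so Delta(u) specializes at t_1 = 1 to
    a Wronskian, and the components of u are independent when the curve
    spans the space. *)
Lemma Delta_neq0 n (u : 'cV[P]_4) : (0 < n)%N -> homogeneous n u ->
  ~ in_hyperplane (curve u) -> Delta u != 0.
Proof.
move=> n0 hu nh.
pose f : 'cV[{poly R}]_4 := map_mx (@dehom R) u.
have indf : lin_indep f.
  move=> h /matrixP/(_ 0 0); rewrite !mxE => hf; apply: (curve_spans nh).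
  apply/matrixP => i j; rewrite !ord1 [RHS]mxE.
  apply: (@dehom_inj _ n); rewrite ?rpred0 //.
    by rewrite mxE; apply: rpred_sum => k _; rewrite mxE mul_mpolyC dhomogZ.
  rewrite /dehom rmorph0 -hf mxE (rmorph_sum (horner2 'X 1)); apply: eq_bigr => k _.
  by rewrite !mxE rmorphM /= horner2C.
have := wronskian_neq0 indf; apply: contra => /eqP D0.
(* Once multiplied by n, the column f of the Wronskian matrix is a combination of
   columns of D(u), by Euler's relation; f', f'' and f''' are such columns. *)
pose d : 'rV[{poly R}]_4 := \row_j (if j == 0 then n%:R else 1).
pose T : 'M[{poly R}]_4 := \matrix_(k, j) tnth [tuple
   (if k == 0 :> nat then 'X else (k == 1 :> nat)%:R); (k == 0 :> nat)%:R;
   (k == 2 :> nat)%:R; (k == 3 :> nat)%:R] j.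
have dehomDn k p : dehom p^`M(0, k) = (dehom p)^`(k).
  by elim: k => [|k IH]; rewrite ?mderivn0 // mderivnS dehom_mderiv0 IH.
have fE i : f i 0 = dehom (u i 0) by rewrite mxE.
have eul i : 'X * (f i 0)^`() + dehom (u i 0)^`M(1) = n%:R * f i 0.
  move/euler2/(congr1 (@dehom R)): (hu i); rewrite rmorphD !rmorphM rmorphMn /=.
  by rewrite {1 3}/dehom !horner2X !mxE mul1r -dehom_mderiv0 mulr_natl.
have WE : wronskian_mx f *m diag_mx d = map_mx (@dehom R) (Dmx u) *m T.
  apply/matrixP => i j; rewrite mul_mx_diag [LHS]mxE [RHS]mxE.
  rewrite !big_ord_recl big_ord0 addr0 !mxE /= !mderivn1 !mderivn0.
  case: j => -[|[|[|[|//]]]] lt4; rewrite !(tnth_nth 0) /=.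
  - rewrite !mulr0 !addr0 mulr1 mulrC -[dehom (u i 0)]fE -eul mxE.
    by rewrite dehom_mderiv0 mulrC.
  - by rewrite !mulr0 !addr0 !mulr1 dehom_mderiv0.
  - by rewrite !mulr0 !mulr1 !add0r addr0 dehomDn.
  by rewrite !mulr0 !mulr1 !add0r dehomDn.
have := congr1 determinant WE; rewrite !det_mulmx det_map_mx.
rewrite -/(Delta u) D0 rmorph0 mul0r.
move/eqP; rewrite mulf_eq0 => /orP[] //; rewrite det_diag => /prodf_eq0[j _].
rewrite mxE; case: ifP => _; last by rewrite oner_eq0.
by rewrite -polyC_natr polyC_eq0 pnatr_eq0 gtn_eqF.
Qed.
End DeltaNeq0.

(** * Parametrizations with coprime components *)

(** The polynomial [g] is a greatest common divisor of the [f i]. *)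
Lemma poly_bezout (F : fieldType) n (f : 'I_n -> {poly F}) :
  exists (g : {poly F}) (s : 'I_n -> {poly F}),
    (forall i, g %| f i) /\ g = \sum_i s i * f i.
Proof.
elim: n f => [|n IH] f.
  by exists 0, (fun=> 0); split=> [[]//|]; rewrite big_ord0.
have [g [s [gf gE]]] := IH (fun i => f (lift ord0 i)).
have [[a b] /= ab] := Bezoutp (f ord0) g.
exists (a * f ord0 + b * g).
exists (fun i => if unlift ord0 i is Some j then b * s j else a).
split=> [i|].
  rewrite (eqp_dvdl _ ab); case: (unliftP ord0 i) => [j|] ->; last exact: dvdp_gcdl.
  exact: dvdp_trans (dvdp_gcdr _ _) (gf j).
rewrite big_ord_recl unlift_none; congr (_ + _); rewrite gE big_distrr /=.
by apply: eq_bigr => i _; rewrite liftK mulrA.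
Qed.

Lemma meval0_homog (F : fieldType) k n (p : {mpoly F[k]}) :
  p \is n.+1.-homog -> p.@[fun=> 0] = 0.
Proof.
move=> hp; have := mmap_homog (idfun : {rmorphism F -> F}) (fun=> 0) 0 hp.
by rewrite exprS !mul0r => p0; exact: p0.
Qed.

Lemma dhomog_nonunit (F : fieldType) k n (p : {mpoly F[k]}) :
  p \is n.+1.-homog -> p \isn't a GRing.unit.
Proof.
move=> hp; apply/negP => /(rmorph_unit (meval (fun=> 0))) /=.
by rewrite (meval0_homog hp) unitr0.
Qed.

Section Coprime.
Variable R : realType.
Notation P := {mpoly R[2]}.
Variables (n : nat) (u : 'cV[P]_4).
Hypotheses (n0 : (0 < n)%N) (hu : homogeneous n u) (cu : coprime_components u).

Let u0 : exists i, dehom (u i 0) != 0.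
Proof.
have [/existsP//|] := boolP [exists i, dehom (u i 0) != 0].
rewrite negb_exists => /forallP u0; have : (0 : P) \is a GRing.unit.
  apply: cu => i; exists 0; rewrite mul0r; apply: (@dehom_inj _ n); rewrite ?rpred0 //.
  by rewrite rmorph0; apply/eqP/negPn/u0.
by rewrite unitr0.
Qed.

(** A nonconstant common divisor of the dehomogenized components would give, once
    homogenized, a common factor of the components of u. *)
Lemma coprime_dehom : exists s : 'I_4 -> {poly R}, \sum_i s i * dehom (u i 0) = 1.
Proof.
have [g [s [gu gE]]] := poly_bezout (fun i => dehom (u i 0)).
have [i ui0] := u0.
have g0 : g != 0 by apply: contraNneq ui0 => g0; rewrite -dvd0p -g0.
have [sg|sg] := eqVneq (size g) 1%N.
  have /size_poly1P[c c0 gc] : size g == 1%N by rewrite sg.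
  exists (fun i => c^-1%:P * s i); under eq_bigr do rewrite -mulrA.
  by rewrite -big_distrr /= -gE gc -polyCM mulVf.
have sgE : (size g).-1 = (size g).-2.+1.
  by rewrite prednK // -subn1 subn_gt0 ltn_neqAle eq_sym sg size_poly_gt0.
have /negP[] : homogenize (size g).-1 g \isn't a GRing.unit.
  by apply: (@dhomog_nonunit _ _ (size g).-2); rewrite -sgE dhomog_homogenize.
apply: cu => j; exists (homogenize (n - (size g).-1) (dehom (u j 0) %/ g)).
have sgn : ((size g).-1 <= n)%N.
  have := leq_trans (dvdp_leq ui0 (gu i)) (size_dehom (hu i)).
  by case: (size g).
apply: (@dehom_inj _ n) => //.
  by rewrite -[X in X.-homog](subnKC sgn); apply: dhomogM; apply: dhomog_homogenize.
rewrite rmorphM /= !homogenizeK ?prednK ?size_poly_gt0 //; first by rewrite mulrC divpK.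
rewrite size_divp // -subSn // leq_sub2r //; exact: size_dehom.
Qed.

(** If all the coefficients of t_0^n vanished, t_1 would divide every component. *)
Lemma coprime_top : exists i, (dehom (u i 0))`_n != 0.
Proof.
have [/existsP//|] := boolP [exists i, (dehom (u i 0))`_n != 0].
rewrite negb_exists => /forallP un.
have /negP[] : ('X_1 : P) \isn't a GRing.unit.
  by apply: (@dhomog_nonunit _ _ 0); rewrite dhomogX /= mdeg1.
apply: cu => i; exists (homogenize n.-1 (dehom (u i 0))).
apply: (@dehom_inj _ n) => //.
  rewrite -[X in X.-homog](prednK n0) -[X in X.-homog]add1n.
  apply: dhomogM; last exact: dhomog_homogenize.
  by rewrite dhomogX /= mdeg1.
rewrite rmorphM /= homogenizeK; first by rewrite /dehom horner2X mul1r.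
rewrite prednK //; apply/leq_sizeP => k; rewrite leq_eqVlt => /predU1P[<-|nk].
  exact/eqP/negPn/un.
by rewrite nth_default //; apply: leq_trans (size_dehom (hu i)) _.
Qed.

Lemma horner2_dehom (f g : {poly R}) p : p \is n.-homog ->
  horner2 f g p = \sum_(k < n.+1) (dehom p)`_k *: (f ^+ k * g ^+ (n - k)).
Proof. by move=> hp; rewrite -{1}(dehomK hp) horner2_homogenize. Qed.

(** Coprimality is preserved by substituting coprime polynomials f, g. Homogenizing
    a Bezout relation writes a power of t_1 as a combination of the u_i, so a common
    divisor l of the u_i(f,g) divides a power of g. On the other hand gcd(l,g)
    divides u_i(f,g), which is congruent to a multiple of f^n modulo g; by
    [coprime_top] this multiple can be taken nonzero, and f is prime to g. *)
Lemma coprime_horner2 (f g l : {poly R}) : coprimep f g ->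
  (forall i, l %| horner2 f g (u i 0)) -> size l = 1%N.
Proof.
move=> cfg lu.
have lg : coprimep l g.
  set d := gcdp l g.
  have [i uin] := coprime_top.
  have df : coprimep d f by rewrite (coprimep_dvdr (dvdp_gcdr l g)) // coprimep_sym.
  have : d %| f ^+ n.
    rewrite -(dvdpZr _ _ uin).
    have /(dvdp_trans (dvdp_gcdl l g)) := lu i; rewrite (horner2_dehom _ _ (hu i)).
    rewrite big_ord_recr /= subnn expr0 mulr1 dvdp_addr //.
    elim/big_ind: _ => [|x y|k _]; [exact: dvdp0 | exact: dvdp_add |].
    rewrite -mul_polyC mulrA dvdp_mull // -(subnSK (ltn_ord k)) exprS dvdp_mulr //.
    exact: dvdp_gcdr.
  rewrite coprimep_def => /coprimep_dvdl/(_ (coprimep_expr n df)).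
  by rewrite coprimepp.
have [s sE] := coprime_dehom.
pose N := \max_i size (s i).
have XE : \sum_i homogenize N (s i) * u i 0 = 'X_1 ^+ (N + n) :> P.
  apply: (@dehom_inj _ (N + n)).
  - by apply: rpred_sum => i _; apply: dhomogM; rewrite ?dhomog_homogenize.
  - by rewrite -[X in X.-homog]mul1n; apply: dhomogMn; rewrite dhomogX /= mdeg1.
  rewrite rmorph_sum rmorphXn /= {2}/dehom horner2X expr1n -sE.
  apply: eq_bigr => i _; rewrite rmorphM /= homogenizeK //.
  by rewrite -ltnS ltnW // ltnS ltnS; apply: (leq_bigmax i).
have : l %| g ^+ (N + n).
  have := congr1 (horner2 f g) XE; rewrite rmorph_sum rmorphXn /= horner2X => <-.
  elim/big_ind: _ => [|x y|k _]; [exact: dvdp0 | exact: dvdp_add |].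
  by rewrite rmorphM /= dvdp_mull //; apply: lu.
move/(coprimep_dvdl)/(_ (coprimep_expr (N + n) lg)).
by rewrite coprimepp => /eqP.
Qed.

(** No point of the projective line is a base point of u. *)
Lemma coprime_coef (alpha beta : R) : (alpha != 0) || (beta != 0) ->
  exists i, \sum_(k < n.+1) (dehom (u i 0))`_k * (alpha ^+ k * beta ^+ (n - k)) != 0.
Proof.
move=> ab.
pose S i := \sum_(k < n.+1) (dehom (u i 0))`_k * (alpha ^+ k * beta ^+ (n - k)).
have [/existsP//|] := boolP [exists i, S i != 0].
rewrite negb_exists => /forallP S0.
have cC (x : R) p : x != 0 -> coprimep x%:P p.
  by move=> x0; rewrite -[x%:P]mulr1 mul_polyC coprimepZl ?coprime1p.
have cab : coprimep alpha%:P beta%:P.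
  by case/orP: ab => ?; [| rewrite coprimep_sym]; apply: cC.
(* If all the values vanished, they would have the common divisor X. *)
suff /(coprime_horner2 cab) : forall i, 'X %| horner2 alpha%:P beta%:P (u i 0).
  by rewrite size_polyX.
move=> i; rewrite (horner2_dehom _ _ (hu i)).
rewrite (_ : \sum_(k < _) _ = (S i)%:P); last first.
  rewrite /S (raddf_sum polyC); apply: eq_bigr => k _.
  by rewrite -!polyC_exp -polyCM -mul_polyC -polyCM.
by move/negPn/eqP: (S0 i) => ->; exact: dvdp0.
Qed.

Lemma coef_horner2_top D (f g : {poly R}) p : p \is n.-homog ->
  (size f <= D.+1)%N -> (size g <= D.+1)%N ->
  (horner2 f g p)`_(n * D) =
    \sum_(k < n.+1) (dehom p)`_k * (f`_D ^+ k * g`_D ^+ (n - k)).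
Proof.
move=> hp sf sg; rewrite (horner2_dehom _ _ hp) coef_sum; apply: eq_bigr => k _.
rewrite coefZ; congr (_ * _).
have topX (h : {poly R}) m : (size h <= D.+1)%N -> has_top (m * D) (h ^+ m) (h`_D ^+ m).
  move=> sh; elim: m => [|m IH]; first exact: has_top1.
  by rewrite mulSn !exprS; apply: has_topM.
have [_] := has_topM (topX f k sf) (topX g (n - k)%N sg).
by rewrite -mulnDl subnKC // -ltnS.
Qed.

(** If u o (f : g) and r are the same rational map into projective space, r has
    coprime components and degree at most n, then (f : g) is of degree at most 1.
    Indeed, after removing the common factor of f and g the vector u(f,g) has
    coprime components, like r, hence differs from r by a constant; and its degree
    is n max(deg f, deg g), since no top coefficient can cancel in all the
    components by [coprime_coef]. *)
Lemma linear_of_coprime_relation (r : 'I_4 -> {poly R}) (f g : {poly R}) :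
  (forall i, size (r i) <= n.+1)%N -> (exists s, \sum_i s i * r i = 1) ->
  (f != 0) || (g != 0) ->
  (forall i j, horner2 f g (u i 0) * r j = horner2 f g (u j 0) * r i) ->
  exists l a b c d : R, l != 0 /\
    forall i, horner2 (a *: 'X + b%:P) (c *: 'X + d%:P) (u i 0) = l *: r i.
Proof.
move=> sr [s sE] fg0 rel.
pose h := gcdp f g; pose f' := f %/ h; pose g' := g %/ h.
have fE : f = h * f' by rewrite mulrC divpK ?dvdp_gcdl.
have gE : g = h * g' by rewrite mulrC divpK ?dvdp_gcdr.
have h0 : h != 0 by rewrite gcdp_eq0 negb_and.
have cfg : coprimep f' g' by apply: coprimep_div_gcd.
have {}rel i j : horner2 f' g' (u i 0) * r j = horner2 f' g' (u j 0) * r i.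
  apply: (mulfI (expf_neq0 n h0)); rewrite !mulrA.
  by rewrite -!(horner2_homog _ _ _ (hu _)) -fE -gE.
(* The r_i generate the unit ideal, so the factor of proportionality to r is a
   polynomial. *)
pose lam := \sum_i s i * horner2 f' g' (u i 0).
have uE i : horner2 f' g' (u i 0) = lam * r i.
  rewrite -[LHS]mul1r -sE /lam !big_distrl /=; apply: eq_bigr => j _.
  by rewrite -!mulrA; congr (_ * _); rewrite mulrC rel.
have /eqP/size_poly1P[l l0 lE] : size lam = 1%N.
  by apply: (coprime_horner2 cfg) => i; rewrite uE dvdp_mulr.
pose D := (maxn (size f') (size g')).-1.
have fg'0 : (f' != 0) || (g' != 0).
  apply: contraTT fg0; rewrite !negb_or !negbK fE gE => /andP[/eqP-> /eqP->].
  by rewrite mulr0 eqxx.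
have sD : maxn (size f') (size g') = D.+1.
  by rewrite prednK // leq_max !size_poly_gt0.
have sf : (size f' <= D.+1)%N by rewrite -sD leq_maxl.
have sg : (size g' <= D.+1)%N by rewrite -sD leq_maxr.
have topD : (f'`_D != 0) || (g'`_D != 0).
  move: sD; rewrite /maxn; case: ifP => _ e; apply/orP; [right|left];
    by rewrite -[D]/(D.+1.-1) -e -/(lead_coef _) lead_coef_eq0 -size_poly_gt0 e.
have [i] := coprime_coef topD.
rewrite -(coef_horner2_top (hu i) sf sg) uE lE mul_polyC coefZ.
rewrite mulf_eq0 negb_or l0 /= => rD.
have D1 : (D <= 1)%N.
  rewrite -(leq_pmul2l n0) muln1 leqNgt; apply: contra rD => nD.
  by rewrite nth_default // (leq_trans (sr i)).
have linE (p : {poly R}) : (size p <= D.+1)%N -> p = p`_1 *: 'X + (p`_0)%:P.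
  move=> sp; apply/polyP => k; rewrite coefD coefZ coefX coefC.
  case: k => [|[|k]]; rewrite ?mulr0 ?mulr1 ?addr0 ?add0r //.
  by rewrite nth_default // (leq_trans sp) // ltnS (leq_trans D1).
exists l, f'`_1, f'`_0, g'`_1, g'`_0; split=> // j.
by rewrite -!linE // uE lE mul_polyC.
Qed.
End Coprime.

(** * Projective equivalences and linear reparametrizations *)

Lemma horner_ext (R : numFieldType) (p q : {poly R}) :
  (forall x, p.[x] = q.[x]) -> p = q.
Proof.
move=> pq; apply/eqP; rewrite -subr_eq0; apply/negPn/negP => d0.
pose rs := [seq i%:R : R | i <- iota 0 (size (p - q))].
case/eqP: d0; apply: (@roots_geq_poly_eq0 _ _ rs).
- by apply/allP => x _; rewrite rootE hornerD hornerN pq subrr.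
- by rewrite map_inj_uniq ?iota_uniq // => i j /eqP; rewrite eqr_nat => /eqP.
by rewrite size_map size_iota.
Qed.

Section Curves.
Variable R : realType.
Notation P := {mpoly R[2]}.
Notation K := {fraction P}.
Notation "''t_0'" := ('X_(0 : 'I_2) : P).
Notation "''t_1'" := ('X_(1 : 'I_2) : P).
Implicit Types (p q u : 'cV[P]_4) (M N : 'M[R]_4).

Notation cmx := (map_mx (@mpolyC 2 R)).

Definition linforms M : 4.-tuple {mpoly R[4]} :=
  [tuple \sum_j M i j *: 'X_j | i < 4].

Lemma meval_linforms M (F : {mpoly R[4]}) (x : 'cV[R]_4) :
  (F \mPo linforms M).@[fun i => x i 0] = F.@[fun i => (M *m x) i 0].
Proof.
rewrite comp_mpoly_meval; apply: meval_eq => i; rewrite tnth_mktuple mxE.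
by rewrite (raddf_sum (meval _)); apply: eq_bigr => j _; rewrite /= mevalZ mevalXU.
Qed.

Lemma dhomog_linforms M d (F : {mpoly R[4]}) :
  F \is d.-homog -> F \mPo linforms M \is d.-homog.
Proof.
move=> hF; rewrite -[d]muln1; apply: dhomog_comp => // i.
rewrite tnth_mktuple; apply: rpred_sum => j _; apply: dhomogZ.
by rewrite dhomogX /= mdeg1.
Qed.

Lemma evalv_mul M p t : evalv (cmx M *m p) t = M *m evalv p t.
Proof.
apply/colP => i; rewrite !mxE (raddf_sum (meval _)); apply: eq_bigr => j _.
by rewrite !mxE /= mevalM mevalC.
Qed.

Lemma curve_evalv u t : t != 0 -> evalv u t != 0 -> curve u (evalv u t).
Proof. by move=> t0 u0; split=> // d F _; apply. Qed.

Section Linear.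
Variables a b c d : R.
Notation phi := (linsubst a b c d).

Lemma evalv_compv q (t : 'cV[R]_2) : exists2 s : 'cV[R]_2,
  evalv (compv q phi) t = evalv q s & a * d - b * c != 0 -> t != 0 -> s != 0.
Proof.
exists (\col_i (tnth phi i).@[fun i => t i 0]).
  by apply/colP => i; rewrite !mxE comp_mpoly_meval; apply: meval_eq => j; rewrite mxE.
move=> delta0; apply: contra => /eqP/colP s0; apply/eqP.
have := s0 0; have := s0 1.
rewrite !mxE !(tnth_nth 0) /= !mevalD !mevalZ !mevalXU => e1 e0.
have x0 : (a * d - b * c) * t 0 0 = 0.
  transitivity (d * (a * t 0 0 + b * t 1 0) - b * (c * t 0 0 + d * t 1 0)).
    by ring.
  by rewrite e0 e1; ring.
have x1 : (a * d - b * c) * t 1 0 = 0.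
  transitivity (a * (c * t 0 0 + d * t 1 0) - c * (a * t 0 0 + b * t 1 0)).
    by ring.
  by rewrite e0 e1; ring.
apply/colP => -[[|[|//]] lti]; rewrite mxE; apply: (mulfI delta0); rewrite mulr0.
  by rewrite -[RHS]x0; congr (_ * t _ _); apply: val_inj.
by rewrite -[RHS]x1; congr (_ * t _ _); apply: val_inj.
Qed.

Lemma curve_reparam_sub p q M : a * d - b * c != 0 -> M \in unitmx ->
  compv q phi = cmx M *m p -> forall x, curve p x -> curve q (M *m x).
Proof.
move=> delta0 uM qp x [x0 xp]; split.
  by apply: contra x0 => /eqP Mx0; rewrite -[x](mulKmx uM) Mx0 mulmx0.
move=> e F hF Fq; rewrite -meval_linforms; apply: (xp e); first exact: dhomog_linforms.
move=> t t0; rewrite meval_linforms -evalv_mul -qp.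
by have [s -> /(_ delta0 t0)/Fq] := evalv_compv q t.
Qed.
End Linear.

(** The lemma [curve_reparam_sub] gives one inclusion; the other one follows
    by applying it to the inverse projectivity and the inverse substitution. *)
Lemma curve_equivalence a b c d p q M : a * d - b * c != 0 -> M \in unitmx ->
  compv q (linsubst a b c d) = cmx M *m p ->
  projective_equivalence M (curve p) (curve q).
Proof.
move=> delta0 uM qp; split=> // y; split=> [qy|[x px ->]].
  2: exact: curve_reparam_sub qp x px.
exists (invmx M *m y); last by rewrite mulKVmx.
set e := (a * d - b * c)^-1.
apply: (@curve_reparam_sub (e * d) (- (e * b)) (- (e * c)) (e * a) q) => //; first last.
- apply: (can_inj (mulKmx (_ : cmx M \in unitmx))).
    by rewrite map_unitmx.
  rewrite mulmxA -map_mxM mulmxV // map_mx1 mul1mx.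
  pose psi := linsubst (e * d) (- (e * b)) (- (e * c)) (e * a).
  apply/colP => i; move/colP/(_ i): qp => /(congr1 (comp_mpoly psi)).
  rewrite !mxE linsubst_inv // => ->; rewrite rmorph_sum; apply: eq_bigr => j _.
  by rewrite rmorphM /= !mxE comp_mpolyC.
- by rewrite unitmx_inv.
have -> : e * d * (e * a) - - (e * b) * - (e * c) = e.
  by rewrite -[RHS]mulr1 -(mulVf delta0) -/e; ring.
by rewrite invr_eq0.
Qed.

(** Composing the projectivity with the inverse g of q gives the pair of forms
    (G_0, G_1) = g(M p), and q(G_0, G_1) is proportional to M p at every parameter,
    because M p(t) lies on the curve of q. The pair is not identically zero, or
    else g would vanish on the whole curve of q. Since p and q have the same
    degree, [linear_of_coprime_relation] shows that it is linear up to a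
    common factor. *)
Lemma curve_reparam n p q M : (0 < n)%N -> homogeneous n p -> homogeneous n q ->
  proper_param q -> coprime_components p -> coprime_components q ->
  projective_equivalence M (curve p) (curve q) ->
  exists l a b c d : R, l != 0 /\ compv q (linsubst a b c d) = cmx (l *: M) *m p.
Proof.
move=> n0 hp hq [d [g [hg [t0 [t00 qt0 gqt0]] _ gq]]] cp cq [uM pq].
pose mp := cmx M *m p.
have hmp : homogeneous n mp.
  by move=> i; rewrite mxE; apply: rpred_sum => j _; rewrite mxE mul_mpolyC dhomogZ.
have [G [hG GE]] : exists G : 'I_2 -> P, (forall k, G k \is (d * n).-homog) /\
    (forall k (t : 'cV[R]_2), (G k).@[fun i => t i 0] = (evalv g (M *m evalv p t)) k 0).
  exists (fun k => g k 0 \mPo [tuple mp i 0 | i < 4]); split=> [k|k t].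
    by apply: dhomog_comp => // i; rewrite tnth_mktuple.
  rewrite comp_mpoly_meval !mxE; apply: meval_eq => i.
  by rewrite tnth_mktuple -evalv_mul [RHS]mxE.
pose r i := dehom (mp i 0).
have rs : exists s, \sum_i s i * r i = 1.
  have [s' s'E] := coprime_dehom hp cp.
  exists (fun i => \sum_j s' j * (invmx M j i)%:P).
  rewrite -s'E; under eq_bigr do rewrite big_distrl /=.
  rewrite exchange_big; apply: eq_bigr => j _ /=.
  under eq_bigr do rewrite -mulrA; rewrite -big_distrr; congr (_ * _).
  have pE : p = cmx (invmx M) *m mp.
    by rewrite mulmxA -map_mxM mulVmx // map_mx1 mul1mx.
  rewrite /r [in RHS]pE [in RHS]mxE (rmorph_sum (@dehom R)); apply: eq_bigr => i _.
  by rewrite rmorphM [map_mx _ _ _ _]mxE /= /dehom horner2C.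
have G0 : (dehom (G 0) != 0) || (dehom (G 1) != 0).
  apply: contraNT gqt0; rewrite negb_or !negbK => /andP[/eqP e0 /eqP e1].
  have Gk0 k : G k = 0.
    apply: (@dehom_inj _ (d * n)); rewrite ?rpred0 // rmorph0.
    case: k => -[|[|//]] lti; [rewrite -[RHS]e0 | rewrite -[RHS]e1];
    by congr (dehom (G _)); apply: val_inj.
  have [x [x0 xp] qx] := (pq _).1 (curve_evalv t00 qt0).
  apply/eqP/colP => k; rewrite [RHS]mxE mxE qx -meval_linforms.
  apply: (xp d); first exact: dhomog_linforms.
  move=> t _; rewrite meval_linforms; have := GE k t.
  by rewrite Gk0 meval0 mxE.
have rel i j : horner2 (dehom (G 0)) (dehom (G 1)) (q i 0) * r j =
               horner2 (dehom (G 0)) (dehom (G 1)) (q j 0) * r i.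
  apply: horner_ext => x; rewrite !hornerM.
  pose t : 'cV[R]_2 := \col_i tnth [tuple x; 1] i.
  have t_neq0 : t != 0.
    by apply/eqP => /colP/(_ 1)/eqP; rewrite !mxE (tnth_nth 0) /= oner_eq0.
  have dehomE (f : P) : (dehom f).[x] = f.@[fun i => t i 0].
    rewrite horner_horner2 hornerX hornerC; apply: meval_eq => k.
    by rewrite mxE.
  pose y := M *m evalv p t.
  have rE k : (r k).[x] = y k 0 by rewrite dehomE /y -evalv_mul [RHS]mxE.
  have qE k : (horner2 (dehom (G 0)) (dehom (G 1)) (q k 0)).[x]
      = evalv q (evalv g y) k 0.
    rewrite horner_horner2 !dehomE !GE [RHS]mxE; apply: meval_eq => -[[|[|//]] lti];
    by rewrite (tnth_nth 0) /=; congr (evalv g _ _ _); apply: val_inj.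
  rewrite !qE !rE.
  have [y0|y0] := eqVneq y 0; first by rewrite y0 !mxE !mulr0.
  (* Where q(g(M p)) vanishes the relation is trivial; elsewhere g inverts q. *)
  have [qgy0|qgy0] := eqVneq (evalv q (evalv g y)) 0.
    by rewrite qgy0 !mxE !mul0r.
  have gy0 : evalv g y != 0.
    apply: contraNneq qgy0 => ->; apply/eqP/colP => k; rewrite !mxE.
    rewrite -[RHS](meval0_homog (_ : q k 0 \is n.-1.+1.-homog)) ?prednK //.
    by apply: meval_eq => z; rewrite mxE.
  have py : curve p (evalv p t).
    apply: curve_evalv => //; apply: contraNneq y0 => pt0.
    by rewrite /y pt0 mulmx0.
  have [l _ ->] := gq y ((pq y).2 (ex_intro2 _ _ _ py erefl)) gy0 qgy0.
  by rewrite !mxE; ring.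
have [l [a [b [c [e [l0 lin]]]]]] :=
  linear_of_coprime_relation n0 hq cq (fun i => size_dehom (hmp i)) rs G0 rel.
exists l, a, b, c, e; split=> //; apply/colP => i.
rewrite map_mxZ -scalemxAl mxE [RHS]mxE.
apply: (@dehom_inj _ n).
- rewrite -[n]muln1; apply: dhomog_comp; first exact: hq.
  by case=> -[|[|//]] lti; rewrite (tnth_nth 0) rpredD //; apply: dhomogZ;
    rewrite dhomogX /= mdeg1.
- by rewrite mul_mpolyC dhomogZ.
transitivity (l *: r i); last by rewrite mul_mpolyC /r /dehom horner2Z.
rewrite /dehom horner2_comp -lin.
by congr (horner2 _ _ _); rewrite (tnth_nth 0) /= rmorphD /= !horner2Z !horner2X /=
  !(tnth_nth 0) /= alg_polyC.
Qed.

End Curves.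

(** * Projectivities acting on the frame and on the curvatures *)

Section Projectivity.
Variable R : realType.
Notation P := {mpoly R[2]}.
Notation K := {fraction P}.
Notation "''t_0'" := ('X_(0 : 'I_2) : P).
Notation "''t_1'" := ('X_(1 : 'I_2) : P).
Implicit Types (p q u : 'cV[P]_4) (M N : 'M[R]_4).
Notation cmx := (map_mx (@mpolyC 2 R)).

Lemma pderiv_mul k l M u : pderiv k l (cmx M *m u) = cmx M *m pderiv k l u.
Proof.
apply/colP => i; rewrite !mxE (raddf_sum (mderivm _)) (raddf_sum (mderivm _)).
by apply: eq_bigr => j _ /=; rewrite !mxE !mderivm_mulC.
Qed.

Lemma Dmx_mul M u : Dmx (cmx M *m u) = cmx M *m Dmx u.
Proof.
rewrite /Dmx !pderiv_mul; apply/matrixP => i j; rewrite !mxE !(tnth_nth 0).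
by case: j => -[|[|[|[|//]]]] lt4; rewrite /= mxE; apply: eq_bigr => k _;
  rewrite !mxE.
Qed.

Lemma Delta_mul M u : Delta (cmx M *m u) = (\det M)%:MP * Delta u.
Proof. by rewrite /Delta Dmx_mul det_mulmx det_map_mx. Qed.

(** A linear map preserves osculating relations, hence the functions I_j. *)
Lemma kappa_mul n M u : M \in unitmx -> Delta u != 0 ->
  kappa1 n (cmx M *m u) = kappa1 n u /\ kappa2 n (cmx M *m u) = kappa2 n u.
Proof.
move=> uM D0.
have DM0 : Delta (cmx M *m u) != 0.
  by rewrite Delta_mul mulf_neq0 // mpolyC_eq0 -unitfE -unitmxE.
have osc : osculating (cmx M *m u) (I1 u) (I2 u) (I3 u) (I4 u).
  move: (osculatingP D0).
  move: (I1 u) (I2 u) (I3 u) (I4 u) => c1 c2 c3 c4 oscu i.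
  have pE k l : tof (pderiv k l (cmx M *m u) i 0)
      = \sum_j tof (M i j)%:MP * tof (pderiv k l u j 0).
    rewrite pderiv_mul mxE [LHS](rmorph_sum (@tofrac P)); apply: eq_bigr => j _.
    by rewrite mxE /tof rmorphM.
  rewrite !pE !big_distrr -!big_split /=; apply: eq_bigr => j _.
  by rewrite (oscu j) !mulrDr !(mulrCA (tof _)).
have [e1 e2 e3 e4] := osculating_unique DM0 osc.
have cong (f : K -> K -> K -> K -> K) i1 i2 i3 i4 j1 j2 j3 j4 :
  i1 = j1 -> i2 = j2 -> i3 = j3 -> i4 = j4 -> f i1 i2 i3 i4 = f j1 j2 j3 j4.
  by move=> -> -> -> ->.
split; [rewrite (kappa1E n (cmx M *m u)) (kappa1E n u)
       | rewrite (kappa2E n (cmx M *m u)) (kappa2E n u)];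
  exact: (cong _ _ _ _ _ _ _ _ _ e1 e2 e3 e4).
Qed.

Lemma det_kernel (D : idomainType) k (A : 'M[D]_k) (v : 'cV[D]_k) :
  \det A != 0 -> A *m v = 0 -> v = 0.
Proof.
move=> A0 Av; have : \adj A *m A *m v = 0 by rewrite -mulmxA Av mulmx0.
rewrite mul_adj_mx mul_scalar_mx => /colP v0; apply/colP => i; have /eqP := v0 i.
by rewrite !mxE mulf_eq0 (negPf A0) /= => /eqP.
Qed.

(** If the two linear forms are proportional, then so are the derivatives of
    q o phi in t_0 and t_1, which are two columns of D(q o phi). *)
Lemma linsubst_det a b c d q :
  Delta (compv q (linsubst a b c d)) != 0 -> a * d - b * c != 0.
Proof.
set phi := linsubst _ _ _ _; set u := compv q phi => D0; apply/negP => /eqP delta0.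
have comb x y :
    (forall i, x *: (u i 0)^`M(0) + y *: (u i 0)^`M(1) = 0) -> x = 0 /\ y = 0.
  move=> xy; pose v : 'cV[P]_4 := \col_j tnth [tuple x%:MP; y%:MP; 0; 0] j.
  have v0 : v = 0.
    apply: det_kernel D0 _; apply/colP => i; rewrite !mxE !big_ord_recl big_ord0 !mxE.
    rewrite !(tnth_nth 0) /= !mulr0 !addr0 !mderivn0 !mderivn1 mulrC mul_mpolyC.
    by rewrite [X in _ + X]mulrC mul_mpolyC -[RHS](xy i) !mxE.
  have := congr1 (fun w : 'cV[P]_4 => w 0 0) v0.
  have := congr1 (fun w : 'cV[P]_4 => w 1 0) v0.
  by rewrite !mxE !(tnth_nth 0) /= => /eqP + /eqP; rewrite !mpolyC_eq0 => /eqP-> /eqP->.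
have dmu x y i : x *: (u i 0)^`M(0) + y *: (u i 0)^`M(1) =
    (x * a + y * b) *: ((q i 0)^`M(0) \mPo phi)
    + (x * c + y * d) *: ((q i 0)^`M(1) \mPo phi).
  rewrite [u i 0]mxE (mderiv_linsubst _ _ _ _ (q i 0) 0).
  rewrite (mderiv_linsubst _ _ _ _ (q i 0) 1).
  move: (_ \mPo phi) (_ \mPo phi) => A0 A1.
  by rewrite !scalerDr !scalerA addrACA -!scalerDl.
have [d0 c0] : d = 0 /\ - c = 0.
  apply: comb => i; rewrite dmu (_ : d * a + _ = 0); last by rewrite -delta0; ring.
  by rewrite (_ : d * c + _ = 0) ?scale0r ?addr0 //; ring.
have [b0 a0] : b = 0 /\ - a = 0.
  apply: comb => i; rewrite dmu (_ : b * a + _ = 0); last by ring.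
  by rewrite (_ : b * c + _ = 0) ?scale0r ?addr0 // -[RHS]oppr0 -delta0; ring.
(* All four coefficients vanish, so the first column of D(q o phi) is zero. *)
have [/eqP] : (1 : R) = 0 /\ (0 : R) = 0; last by rewrite oner_eq0.
apply: comb => i; rewrite dmu b0 -[a]opprK a0 -[c]opprK c0 d0.
by rewrite !oppr0 !mulr0 !addr0 !scale0r addr0.
Qed.

Lemma compv_homog n q a b c d :
  homogeneous n q -> homogeneous n (compv q (linsubst a b c d)).
Proof.
move=> hq i; rewrite mxE -[n]muln1; apply: dhomog_comp; first exact: hq.
by case=> -[|[|//]] lti; rewrite (tnth_nth 0) rpredD //; apply: dhomogZ;
  rewrite dhomogX /= mdeg1.
Qed.

(** The first two columns of D(u) are the first derivatives of u, and they
    determine u by Euler's relation. *)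
Lemma Dmx_inj n p q M : (0 < n)%N -> homogeneous n p -> homogeneous n q ->
  Dmx q = cmx M *m Dmx p -> q = cmx M *m p.
Proof.
move=> n0 hp hq DE.
have cE (v : 'cV[P]_4) : Dmx q *m v = cmx M *m (Dmx p *m v) by rewrite DE mulmxA.
pose v : 'cV[P]_4 := \col_j tnth [tuple 't_0; 't_1; 0; 0] j.
have eul u : homogeneous n u -> Dmx u *m v = n%:R *: u.
  move=> hu; apply/colP => i; rewrite !mxE !big_ord_recl big_ord0 !mxE.
  rewrite !(tnth_nth 0) /= !mulr0 !addr0 !mderivn0 !mderivn1 mulr_natl.
  by rewrite -(euler2 (hu i)) addrC [X in X + _]mulrC [X in _ + X]mulrC addrC.
have n0' : (n%:R : P) != 0 by rewrite -mpolyC_nat mpolyC_eq0 pnatr_eq0 gtn_eqF.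
have := cE v; rewrite !eul // -scalemxAr => /colP e.
by apply/colP => i; have := e i; rewrite !mxE => /(mulfI n0').
Qed.

End Projectivity.

Theorem theorem11 (R : realType) (n : nat) (p q : 'cV[{mpoly R[2]}]_4) :
  (4 <= n)%N ->
  homogeneous n p -> homogeneous n q ->
  proper_param p -> proper_param q ->
  coprime_components p -> coprime_components q ->
  ~ in_hyperplane (curve p) -> ~ in_hyperplane (curve q) ->
  (projectively_equivalent (curve p) (curve q) <->
     exists (a b c d : R) (M : 'M[R]_4), curvature_match n p q a b c d M)
  /\
  (forall (a b c d : R) (M : 'M[R]_4), curvature_match n p q a b c d M ->
     projective_equivalence M (curve p) (curve q)).
Proof.
move=> n4 hp hq _ pq cp cq np nq.
have n0 : (0 < n)%N by apply: leq_trans n4.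
have Dp := Delta_neq0 n0 hp np; have Dq := Delta_neq0 n0 hq nq.
have uDp : map_mx (@tof R) (Dmx p) \in unitmx.
  by rewrite unitmxE unitfE det_map_mx /= tofrac_eq0; exact: Dp.
have tofcE (M : 'M[R]_4) : constmx M = map_mx (@tof R) (map_mx (@mpolyC 2 R) M).
  by apply/matrixP => i j; rewrite !mxE.
have suff_match a b c d M : curvature_match n p q a b c d M ->
    projective_equivalence M (curve p) (curve q).
  case=> delta0 _ _ DqE.
  have {}DqE : Dmx (compv q (linsubst a b c d)) = map_mx (@mpolyC 2 R) M *m Dmx p.
    have := congr1 (mulmx^~ (map_mx (@tof R) (Dmx p))) DqE.
    rewrite /Dquotient mulmxKV // tofcE -map_mxM => /matrixP e.
    apply/matrixP => i j; have := e i j; rewrite mxE [RHS]mxE => /eqP.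
    by rewrite /tof tofrac_eq => /eqP.
  have qE := Dmx_inj n0 hp (compv_homog a b c d hq) DqE.
  have uM : M \in unitmx.
    rewrite -row_free_unit; apply: inj_row_free => h hM; apply: (curve_spans nq).
    have : map_mx (@mpolyC 2 R) h *m compv q (linsubst a b c d) = 0.
      by rewrite qE mulmxA -map_mxM hM map_mx0 mul0mx.
    move=> /matrixP/(_ 0 0); rewrite !mxE => hq0.
    apply/matrixP => i j; rewrite !ord1 [RHS]mxE; apply: (linsubst_inj delta0).
    rewrite comp_mpoly0 -[RHS]hq0 mxE rmorph_sum; apply: eq_bigr => k _.
    by rewrite !mxE rmorphM /= comp_mpolyC.
  exact: curve_equivalence delta0 uM qE.
split=> //; split=> [[M Mpq]|[a [b [c [d [M match_M]]]]]]; last first.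
  by exists M; apply: suff_match match_M.
have [l [a [b [c [d [l0 qE]]]]]] := curve_reparam n0 hp hq pq cp cq Mpq.
have uM : l *: M \in unitmx.
  by rewrite unitmxZ ?unitfE //; case: Mpq.
have Dqphi : Delta (compv q (linsubst a b c d)) != 0.
  rewrite qE Delta_mul; apply: mulf_neq0; last exact: Dp.
  by rewrite mpolyC_eq0 -unitfE -unitmxE.
have delta0 := linsubst_det Dqphi.
exists a, b, c, d, (l *: M).
have [k1 k2] := kappa_compv n4 hq delta0 Dq Dqphi.
have [m1 m2] := kappa_mul n uM Dp.
split; first exact: delta0.
- exact: etrans (etrans (esym m1) (congr1 (kappa1 n) (esym qE))) k1.
- exact: etrans (etrans (esym m2) (congr1 (kappa2 n) (esym qE))) k2.
rewrite /Dquotient qE Dmx_mul [map_mx _ (_ *m _)](map_mxM (@tofrac {mpoly R[2]})).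
by rewrite mulmxK // tofcE.
Qed.
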